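(* Let $N\ge0$, $\vec{\mathbf a}_N=(a(0),\dots,a(N))\in\mathbb C^{N+1}$, $P_1>0$, $D_f^0=\{f:\frac1{2\pi}\int_{-\pi}^\pi f(\lambda)d\lambda\le P_1\}$. Let $f_0\in D_f^0$, let $f_0^{-1}$ be integrable, put $C_N^0(e^{i\lambda})=\sum_{j=0}^N((B_N^0)^{-1}\vec{\mathbf a}_N)_je^{ij\lambda}$, and let the function $$h(f_0)=\sum_{j=0}^Na(j)e^{ij\lambda}-C_N^0(e^{i\lambda})f_0^{-1}(\lambda)$$ be bounded. Suppose that for some constant $\alpha_1>0$ $$f_0(\lambda)=\alpha_1\left|C_N^0(e^{i\lambda})\right|$$ and that $f_0$ determines a solution to the optimization problem $$\max_{f\in D_f^0}\langle B_N^{-1}\vec{\mathbf a}_N,\vec{\mathbf a}_N\rangle=\langle(B_N^0)^{-1}\vec{\mathbf a}_N,\vec{\mathbf a}_N\rangle .$$ Then $f_0$ is the least favourable spectral density in $D_f^0$ for the optimal linear estimate of $A_N\xi=\sum_{j=0}^Na(j)\xi(j)$ based on observations of $\xi(j)$ at $j\in\mathbb Z\setminus\{0,1,\dots,N\}$, and $h^0=h(f_0)$ is the minimax-robust spectral characteristic of the optimal linear estimate of $A_N\xi$.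
   Context: $\xi$ is a zero mean wide sense stationary sequence with spectral density $f$: $E\xi(j+k)\overline{\xi(j)}=\frac1{2\pi}\int_{-\pi}^\pi e^{ik\lambda}f(\lambda)d\lambda$. $B_N$ is the $(N+1)\times(N+1)$ matrix with entries $\frac1{2\pi}\int_{-\pi}^\pi f^{-1}(\lambda)e^{-i(k-j)\lambda}d\lambda$, $k,j=0,\dots,N$ (densities $f$ being understood to satisfy the minimality condition $\int f^{-1}d\lambda<\infty$ wherever $B_N^{-1}$ is used), and $B_N^0$ is this matrix for $f_0$. $\langle x,y\rangle=\sum_{k=0}^Nx_k\overline{y_k}$. $L_2^N(f)$ is the closed span of $\{e^{ij\lambda}:j\in\mathbb Z\setminus\{0,\dots,N\}\}$ in $L_2(f)$; for $h\in L_2^N(f)$, $\Delta(h;f)=\frac1{2\pi}\int_{-\pi}^\pi|\sum_{j=0}^Na(j)e^{ij\lambda}-h|^2f\,d\lambda$, and $h(f)$ denotes its minimizer. For a class $D$ of densities, $f_0\in D$ is least favourable if $\Delta(h(f_0);f_0)=\max_{f\in D}\Delta(h(f);f)$; $h^0$ is minimax-robust if $h^0\in H_D=\bigcap_{f\in D}L_2^N(f)$ and $\min_{h\in H_D}\max_{f\in D}\Delta(h;f)=\sup_{f\in D}\Delta(h^0;f)$. *)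

(* Defs.v *)
From mathcomp Require Import all_boot all_order all_algebra.
From mathcomp Require Import all_classical all_reals all_analysis.
From mathcomp Require Export complex.
Set Implicit Arguments.
Unset Strict Implicit.
Unset Printing Implicit Defensive.
Import Order.TTheory GRing.Theory Num.Theory.
Import numFieldNormedType.Exports.
Local Open Scope classical_set_scope.
Local Open Scope ring_scope.
Local Open Scope complex_scope.

Section Interpolation.
Variable R : realType.
Implicit Types (f : R -> R) (g h : R -> R[i]) (D : set (R -> R)).

Notation mu := (@lebesgue_measure R).

Definition freq : set R := `[- pi, pi].

Definition cabs (z : R[i]) : R := Normc.normc z.

(* The library has no measurable structure on [R[i]]: measurability and
   integrals of complex functions are taken componentwise. *)
Definition cmeasurable h : Prop :=
  measurable_fun freq (fun x => complex.Re (h x)) /\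
  measurable_fun freq (fun x => complex.Im (h x)).

Definition cintegral h : R[i] :=
  (\int[mu]_(x in freq) complex.Re (h x))
    +i* (\int[mu]_(x in freq) complex.Im (h x)).

Definition expi (j : int) (x : R) : R[i] := cos (j%:~R * x) +i* sin (j%:~R * x).

Definition spectral_density f : Prop :=
  (forall x, freq x -> 0 <= f x) /\ mu.-integrable freq (EFin \o f).

(* The inverse is the one of [\bar R], for which 0^-1 = +oo; in particular this
   forces [f > 0] almost everywhere, and elsewhere the inverse of [R] can be
   used. *)
Definition minimal f : Prop :=
  mu.-integrable freq (fun x => ((f x)%:E)^-1)%E.

Definition D0 (P1 : R) : set (R -> R) :=
  [set f | spectral_density f /\
     (2 * pi)^-1 * (\int[mu]_(x in freq) f x) <= P1].

Definition Bmx (N : nat) f : 'M[R[i]]_(N.+1) :=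
  \matrix_(k, j) (((2 * pi)^-1)%:C *
    cintegral (fun x => ((f x)^-1)%:C * expi (- (k%:Z - j%:Z)) x)).

Definition inner (N : nat) (x y : 'cV[R[i]]_(N.+1)) : R[i] :=
  \sum_k x k 0 * (y k 0)^*.

Definition Binv_form (N : nat) (a : 'cV[R[i]]_(N.+1)) f : R[i] :=
  inner (invmx (Bmx N f) *m a) a.

(* The values of the form are real, and [<=] on [R[i]] compares elements with
   equal imaginary parts. *)
Definition solves_max (N : nat) (a : 'cV[R[i]]_(N.+1)) D f0 : Prop :=
  [/\ D f0, minimal f0 &
      forall f, D f -> minimal f -> Binv_form a f <= Binv_form a f0].

Definition trigpoly (N : nat) (c : 'cV[R[i]]_(N.+1)) (x : R) : R[i] :=
  \sum_(j < N.+1) c j 0 * expi j x.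

Definition L2dist f g h : \bar R :=
  (((2 * pi)^-1)%:E * \int[mu]_(x in freq) (cabs (g x - h x) ^+ 2 * f x)%:E)%E.

Definition L2 f h : Prop :=
  cmeasurable h /\ (L2dist f h (fun=> 0%R) < +oo)%E.

Definition observed (N : nat) (j : int) : bool := (j < 0) || (N%:Z < j).

Definition in_span (N : nat) g : Prop :=
  exists (s : seq int) (c : int -> R[i]), all (observed N) s /\
    g = fun x => \sum_(j <- s) c j * expi j x.

Definition L2N (N : nat) f h : Prop :=
  L2 f h /\
  forall e : R, 0 < e -> exists2 g, in_span N g & (L2dist f h g < e%:E)%E.

Definition Delta (N : nat) (a : 'cV[R[i]]_(N.+1)) h f : \bar R :=
  L2dist f (trigpoly a) h.

(* [h] is h(f): it exists by the projection theorem and is unique up to null sets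
   of [f(x)dx]. *)
Definition spectral_char (N : nat) (a : 'cV[R[i]]_(N.+1)) f h : Prop :=
  L2N N f h /\ forall g, L2N N f g -> (Delta a h f <= Delta a g f)%E.

Definition least_favourable (N : nat) (a : 'cV[R[i]]_(N.+1)) D f0 : Prop :=
  D f0 /\ exists2 h0, spectral_char a f0 h0 &
    forall f h, D f -> spectral_char a f h -> (Delta a h f <= Delta a h0 f0)%E.

Definition HD (N : nat) D : set (R -> R[i]) :=
  [set h | forall f, D f -> L2N N f h].

(* With [HD N D h0], the equation says that the minimum is attained at [h0]. *)
Definition minimax_robust (N : nat) (a : 'cV[R[i]]_(N.+1)) D (h0 : R -> R[i]) :
    Prop :=
  HD N D h0 /\
  ereal_inf [set ereal_sup [set Delta a h f | f in D] | h in HD N D]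
    = ereal_sup [set Delta a h0 f | f in D].

Definition CN (N : nat) (a : 'cV[R[i]]_(N.+1)) f : R -> R[i] :=
  trigpoly (invmx (Bmx N f) *m a).

Definition hchar (N : nat) (a : 'cV[R[i]]_(N.+1)) f (x : R) : R[i] :=
  trigpoly a x - CN a f x * ((f x)^-1)%:C.

(* Densities and spectral characteristics only matter up to null sets, so
   bounds and equations between them are required almost everywhere. *)
Definition ae_bounded h : Prop :=
  exists M : R, {ae mu, forall x, freq x -> cabs (h x) <= M}.

Definition ae_equal f (g : R -> R) : Prop := {ae mu, forall x, freq x -> f x = g x}.

End Interpolation.

(* Main.v *)
Require Import Defs.
From mathcomp Require Import all_boot all_order all_algebra.
From mathcomp Require Import all_classical all_reals all_analysis.
From mathcomp Require Import measurable_realfun.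
From mathcomp Require Import ring lra.
Set Implicit Arguments.
Unset Strict Implicit.
Unset Printing Implicit Defensive.
Import Order.TTheory GRing.Theory Num.Theory.
Import numFieldNormedType.Exports.
Local Open Scope classical_set_scope.
Local Open Scope ring_scope.
Local Open Scope complex_scope.

(** The error [A - h(f0) = C / f0] has constant modulus [1 / alpha1], so the mean
    square error of the fixed estimate [h(f0)] at a density [f] is
    [alpha1^-2] times the power of [f]; it is maximal at [f0], since [f0] has full
    power (otherwise rescaling it would increase the maximized form). As [h(f0)]
    is also the best estimate at [f0], the pair is a saddle point and both claims
    follow.

    The analytic point is that [h(f0)] lies in [L2N f] for every density [f],
    minimal or not. It is bounded with vanishing Fourier coefficients of index
    [0..N], so it suffices to approximate it by trigonometric polynomials under
    the weight [f + 1]. With [q] a trigonometric polynomial valued in [[0, 1]] and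
    smaller than [1/2] exactly on [(-pi, b)], the polynomials [(1 - q^n)^(2^n)]
    converge boundedly to the indicator of a ray; a pi-lambda argument extends
    this to indicators of measurable sets, hence to bounded functions. *)

Lemma measurable_freq (R : realType) : measurable (@freq R).
Proof. exact: measurable_itv. Qed.

#[local] Hint Extern 0 (measurable (@freq _)) =>
  solve [exact: measurable_freq] : core.

#[local] Instance ae_lebesgue_filter (R : realType) :
  Filter (nbhs (almost_everywhere (@lebesgue_measure R))).
Proof. exact: ae_filter_ringOfSetsType. Qed.

(** * Essentially bounded functions and their integrability *)

Section EssentiallyBounded.
Variable R : realType.
Implicit Types (u v w : R -> R).
Notation mu := (@lebesgue_measure R).
Notation integrable w := (mu.-integrable (@freq R) (EFin \o w)).

Definition ess_bounded u : Prop :=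
  measurable_fun (@freq R) u /\
  exists M : R, {ae mu, forall x, freq x -> `|u x| <= M}.

Lemma ess_bounded_cst (c : R) : ess_bounded (fun=> c).
Proof. by split => //; exists `|c|; apply: aeW => x _; exact: lexx. Qed.

Lemma ess_boundedD u v : ess_bounded u -> ess_bounded v ->
  ess_bounded (fun x => u x + v x).
Proof.
move=> [mu_ [M uM]] [mv [M' vM']]; split; first exact: measurable_funD.
exists (M + M'); move: uM vM'; apply: filterS2 => x ux vx fx.
by apply: le_trans (ler_normD _ _) _; apply: lerD; [exact: ux|exact: vx].
Qed.

Lemma ess_boundedM u v : ess_bounded u -> ess_bounded v ->
  ess_bounded (fun x => u x * v x).
Proof.
move=> [mu_ [M uM]] [mv [M' vM']]; split; first exact: measurable_funM.
exists (M * M'); move: uM vM'; apply: filterS2 => x ux vx fx.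
by rewrite normrM; apply: ler_pM => //; [exact: ux|exact: vx].
Qed.

Lemma ess_boundedN u : ess_bounded u -> ess_bounded (fun x => - u x).
Proof.
move=> /(ess_boundedM (ess_bounded_cst (-1))).
by under eq_fun do rewrite mulN1r.
Qed.

Lemma ess_boundedB u v : ess_bounded u -> ess_bounded v ->
  ess_bounded (fun x => u x - v x).
Proof. by move=> bu /ess_boundedN; exact: ess_boundedD. Qed.

Lemma ess_boundedX u n : ess_bounded u -> ess_bounded (fun x => u x ^+ n).
Proof.
move=> bu; elim: n => [|n IH]; first exact: ess_bounded_cst.
by under eq_fun do rewrite exprS; exact: ess_boundedM.
Qed.

Lemma integrable_cst (c : R) : integrable (fun=> c).
Proof.
apply: (@continuous_compact_integrable _ (fun=> c)); first exact: segment_compact.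
by apply: continuous_subspaceT => x; exact: cvg_cst.
Qed.

Lemma integrableM_ess_bounded u w : ess_bounded u -> integrable w ->
  integrable (fun x => u x * w x).
Proof.
move=> [mu_ [M uM]] iw.
have mw : measurable_fun (@freq R) w.
  by apply/measurable_EFinP; case/integrableP: iw.
have mg : measurable_fun (@freq R) (EFin \o (fun x => u x * w x)).
  by apply/measurable_EFinP; exact: measurable_funM.
have iMw : mu.-integrable (@freq R) (fun x => (M%:E * `|(w x)%:E|)%E).
  by apply: integrableZl => //; exact: (integrable_abse iw).
(* Dominated convergence along a constant sequence: it yields integrability from a domination that
   holds only almost everywhere. *)
have [] // := @dominated_convergence _ _ _ mu _ (@measurable_freq R)
  (fun=> EFin \o (fun x => u x * w x)) _ _ (fun=> mg) mg _ iMw.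
  by apply: aeW => x _; exact: cvg_cst.
move: uM; apply: filterS => x ux n fx /=.
by rewrite lee_fin normrM ler_wpM2r//; exact: ux.
Qed.

Lemma integrable_ess_bounded u : ess_bounded u -> integrable u.
Proof.
move=> /integrableM_ess_bounded -/(_ _ (integrable_cst 1)).
by under [X in _.-integrable _ (_ \o X)]eq_fun do rewrite mulr1.
Qed.

End EssentiallyBounded.

(** * Algebra of trigonometric polynomials *)

Section TrigonometricPolynomials.
Variable R : realType.

Lemma ReM (z t : R[i]) : complex.Re (z * t) =
  complex.Re z * complex.Re t - complex.Im z * complex.Im t.
Proof. by case: z; case: t. Qed.

Lemma ImM (z t : R[i]) : complex.Im (z * t) =
  complex.Re z * complex.Im t + complex.Im z * complex.Re t.
Proof. by case: z; case: t. Qed.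

Lemma expiD (j k : int) (x : R) : expi (j + k) x = expi j x * expi k x.
Proof.
rewrite /expi intrD mulrDl cosD sinD.
by apply/eqP; rewrite eq_complex /= [X in _ && (X == _)]addrC !eqxx.
Qed.

Lemma expi0 (x : R) : expi 0 x = 1.
Proof. by rewrite /expi mul0r cos0 sin0. Qed.

Lemma conj_expi (j : int) (x : R) : ((expi j x)^*)%R = expi (- j) x.
Proof. by rewrite /expi mulrNz mulNr cosN sinN. Qed.

Definition ess_cbounded (h : R -> R[i]) : Prop :=
  ess_bounded (fun x => complex.Re (h x)) /\
  ess_bounded (fun x => complex.Im (h x)).

Lemma ess_cbounded_cst (c : R[i]) : ess_cbounded (fun=> c).
Proof. by split; exact: ess_bounded_cst. Qed.

Lemma ess_cboundedD (g h : R -> R[i]) : ess_cbounded g -> ess_cbounded h ->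
  ess_cbounded (fun x => g x + h x).
Proof.
move=> [g1 g2] [h1 h2]; split.
  by under eq_fun do rewrite raddfD; exact: ess_boundedD.
by under eq_fun do rewrite raddfD; exact: ess_boundedD.
Qed.

Lemma ess_cboundedM (g h : R -> R[i]) : ess_cbounded g -> ess_cbounded h ->
  ess_cbounded (fun x => g x * h x).
Proof.
move=> [g1 g2] [h1 h2]; split.
  by under eq_fun do rewrite ReM; apply: ess_boundedB; exact: ess_boundedM.
by under eq_fun do rewrite ImM; apply: ess_boundedD; exact: ess_boundedM.
Qed.

Lemma ess_cboundedN (h : R -> R[i]) : ess_cbounded h ->
  ess_cbounded (fun x => - h x).
Proof.
move=> [h1 h2]; split.
  by under eq_fun do rewrite raddfN; exact: ess_boundedN.
by under eq_fun do rewrite raddfN; exact: ess_boundedN.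
Qed.

Lemma ess_cboundedB (g h : R -> R[i]) : ess_cbounded g -> ess_cbounded h ->
  ess_cbounded (fun x => g x - h x).
Proof. by move=> bg /ess_cboundedN; exact: ess_cboundedD. Qed.

Lemma ess_cbounded_conj (h : R -> R[i]) : ess_cbounded h ->
  ess_cbounded (fun x => ((h x)^*)%R).
Proof.
move=> [h1 h2]; split.
  suff -> : (fun x => complex.Re ((h x)^*)%R) = (fun x => complex.Re (h x)) by [].
  by apply/funext => x; case: (h x).
suff -> : (fun x => complex.Im ((h x)^*)%R) = (fun x => - complex.Im (h x)).
  exact: ess_boundedN.
by apply/funext => x; case: (h x).
Qed.

Lemma ess_cbounded_sum (I : Type) (s : seq I) (h : I -> R -> R[i]) :
  (forall i, ess_cbounded (h i)) -> ess_cbounded (fun x => \sum_(i <- s) h i x).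
Proof.
move=> bh; elim: s => [|i s IH].
  by under eq_fun do rewrite big_nil; exact: ess_cbounded_cst.
by under eq_fun do rewrite big_cons; exact: ess_cboundedD.
Qed.

Lemma ess_cbounded_expi (j : int) : ess_cbounded (expi j).
Proof.
split; split.
- apply: measurable_funTS; apply: continuous_measurable_fun => x /=.
  apply: continuous_comp; last exact: continuous_cos.
  by apply: cvgM; [exact: cvg_cst|exact: cvg_id].
- by exists 1; apply: aeW => x _; exact: cos_max.
- apply: measurable_funTS; apply: continuous_measurable_fun => x /=.
  apply: continuous_comp; last exact: continuous_sin.
  by apply: cvgM; [exact: cvg_cst|exact: cvg_id].
- by exists 1; apply: aeW => x _; exact: sin_max.
Qed.

(** Pairs of a coefficient and a frequency. Frequencies may repeat, so that a sum is a concatenation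
    and a product runs over all pairs of terms. *)
Definition trig_sum (l : seq (R[i] * int)) (x : R) : R[i] :=
  \sum_(t <- l) t.1 * expi t.2 x.

Lemma ess_cbounded_trig_sum l : ess_cbounded (trig_sum l).
Proof.
apply: (@ess_cbounded_sum _ l (fun t x => t.1 * expi t.2 x)) => t.
by apply: ess_cboundedM; [exact: ess_cbounded_cst|exact: ess_cbounded_expi].
Qed.

(** The coefficients stay complex; the condition carves out a real algebra that contains the
    constants, cosine and sine. *)
Definition trig_real (p : R -> R) : Prop :=
  exists l, forall x, (p x)%:C = trig_sum l x.

Lemma trig_real_cst (c : R) : trig_real (fun=> c).
Proof.
by exists [:: (c%:C, 0)] => x; rewrite /trig_sum big_seq1 expi0 mulr1.
Qed.

Lemma trig_realD (p q : R -> R) : trig_real p -> trig_real q ->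
  trig_real (fun x => p x + q x).
Proof.
move=> [l pl] [m qm]; exists (l ++ m) => x.
by rewrite /trig_sum big_cat /= rmorphD /= pl qm.
Qed.

Lemma trig_realM (p q : R -> R) : trig_real p -> trig_real q ->
  trig_real (fun x => p x * q x).
Proof.
move=> [l pl] [m qm].
exists [seq (s.1 * t.1, s.2 + t.2) | s <- l, t <- m] => x.
rewrite /trig_sum big_allpairs_dep /= rmorphM /= pl qm /trig_sum.
rewrite mulr_suml; apply: eq_bigr => s _; rewrite mulr_sumr.
by apply: eq_bigr => t _; rewrite expiD mulrACA.
Qed.

Lemma trig_realB (p q : R -> R) : trig_real p -> trig_real q ->
  trig_real (fun x => p x - q x).
Proof.
move=> tp /(trig_realM (trig_real_cst (-1))) /(trig_realD tp).
by under eq_fun do rewrite mulN1r.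
Qed.

Lemma trig_realX (p : R -> R) n : trig_real p -> trig_real (fun x => p x ^+ n).
Proof.
move=> tp; elim: n => [|n IH]; first exact: trig_real_cst.
by under eq_fun do rewrite exprS; exact: trig_realM.
Qed.

Lemma trig_real_cos : trig_real (@cos R).
Proof.
exists [:: ((2^-1)%:C, 1 : int); ((2^-1)%:C, -1 : int)] => x.
rewrite /trig_sum big_cons big_seq1 /expi /= mulrNz mulr1z mulNr mul1r cosN sinN.
by apply/eqP; rewrite eq_complex /=; apply/andP; split; apply/eqP; field.
Qed.

Lemma trig_real_sin : trig_real (@sin R).
Proof.
exists [:: (0 +i* (- 2^-1), 1 : int); (0 +i* (2^-1), -1 : int)] => x.
rewrite /trig_sum big_cons big_seq1 /expi /= mulrNz mulr1z mulNr mul1r cosN sinN.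
by apply/eqP; rewrite eq_complex /=; apply/andP; split; apply/eqP; field.
Qed.

Lemma trig_real_sinB (b : R) : trig_real (fun x => sin (x - b)).
Proof.
under eq_fun do rewrite sinB; apply: trig_realB; apply: trig_realM;
  by [exact: trig_real_sin|exact: trig_real_cos|exact: trig_real_cst].
Qed.

Lemma ess_bounded_trig_real p : trig_real p -> ess_bounded p.
Proof.
move=> [l pl]; have [+ _] := ess_cbounded_trig_sum l.
by under eq_fun do rewrite -pl.
Qed.

End TrigonometricPolynomials.

Lemma two_quarters_lt (R : realType) (x y e : R) :
  x < e / 4 -> y < e / 4 -> 2 * x + 2 * y < e.
Proof. by move=> xe ye; lra. Qed.

(** * Closure properties of approximability in $L_2(w)$ *)

Section WeightedApproximation.
Variables (R : realType) (w : R -> R).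
Notation mu := (@lebesgue_measure R).
Notation I u := (Rintegral mu (@freq R) u).
Notation integrable u := (mu.-integrable (@freq R) (EFin \o u)).
Hypothesis w_ge0 : forall x, freq x -> 0 <= w x.
Hypothesis w_int : integrable w.
Implicit Types u v p q : R -> R.

(** Closure of the real trigonometric polynomials in $L_2(w)$, restricted to essentially bounded
    functions so that every squared distance is integrable. *)
Definition trig_approximable u : Prop :=
  ess_bounded u /\
  forall e, 0 < e -> exists2 p, trig_real p &
    I (fun x => (u x - p x) ^+ 2 * w x) < e.

Lemma integrable_sq_dist u v : ess_bounded u -> ess_bounded v ->
  integrable (fun x => (u x - v x) ^+ 2 * w x).
Proof.
move=> bu bv; apply: integrableM_ess_bounded => //.
by apply: ess_boundedX; exact: ess_boundedB.
Qed.

Lemma trig_approximable_trig_real p : trig_real p -> trig_approximable p.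
Proof.
move=> tp; split; first exact: ess_bounded_trig_real.
move=> e e0; exists p => //.
have -> : (fun x => (p x - p x) ^+ 2 * w x) = (fun x => 0 * w x).
  by apply/funext => x; rewrite subrr expr0n mulr0n.
by rewrite RintegralZl// mul0r.
Qed.

Lemma trig_approximableD u v : trig_approximable u -> trig_approximable v ->
  trig_approximable (fun x => u x + v x).
Proof.
move=> [bu au] [bv av]; split; first exact: ess_boundedD.
move=> e e0; have e4 : 0 < e / 4 by rewrite divr_gt0.
have [p tp pe] := au _ e4; have [q tq qe] := av _ e4.
have bp := ess_bounded_trig_real tp; have bq := ess_bounded_trig_real tq.
exists (fun x => p x + q x); first exact: trig_realD.
pose b x := 2 * ((u x - p x) ^+ 2 * w x) + 2 * ((v x - q x) ^+ 2 * w x).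
have iu := integrable_sq_dist bu bp; have iv := integrable_sq_dist bv bq.
have i2u : integrable (fun x => 2 * ((u x - p x) ^+ 2 * w x)).
  exact: (integrableZl _ 2 iu).
have i2v : integrable (fun x => 2 * ((v x - q x) ^+ 2 * w x)).
  exact: (integrableZl _ 2 iv).
apply: (@le_lt_trans _ _ (I b)).
  apply: le_Rintegral => //.
  - by apply: integrable_sq_dist; exact: ess_boundedD.
  - exact: (integrableD _ i2u i2v).
  - move=> x fx; rewrite /b !mulrA -mulrDl; apply: ler_wpM2r; first exact: w_ge0.
    (* The square is the gap in $(s+t)^2 \le 2s^2 + 2t^2$, with $s = u - p$ and $t = v - q$. *)
    by have := sqr_ge0 (u x - p x - (v x - q x)); nra.
by rewrite /b RintegralD// !RintegralZl//; exact: two_quarters_lt.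
Qed.

Lemma trig_approximableZ c u : trig_approximable u ->
  trig_approximable (fun x => c * u x).
Proof.
move=> [bu au]; split; first by apply: ess_boundedM => //; exact: ess_bounded_cst.
(* The summand 1 makes the divisor of [e] positive even for [c = 0]. *)
move=> e e0; have c0 : 0 < c ^+ 2 + 1 by rewrite ltr_wpDl// sqr_ge0.
have [p tp pe] := au _ (divr_gt0 e0 c0).
have bp := ess_bounded_trig_real tp; have iu := integrable_sq_dist bu bp.
exists (fun x => c * p x); first by apply: trig_realM => //; exact: trig_real_cst.
have -> : (fun x => (c * u x - c * p x) ^+ 2 * w x) =
    (fun x => c ^+ 2 * ((u x - p x) ^+ 2 * w x)).
  by apply/funext => x; rewrite -mulrBr exprMn mulrA.
rewrite RintegralZl//; move: pe; rewrite ltr_pdivlMr//; apply: le_lt_trans.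
rewrite mulrC ler_wpM2l// ?lerDl//; apply: Rintegral_ge0 => x fx.
by rewrite mulr_ge0 ?sqr_ge0// w_ge0.
Qed.

Lemma trig_approximableB u v : trig_approximable u -> trig_approximable v ->
  trig_approximable (fun x => u x - v x).
Proof.
move=> au /(trig_approximableZ (-1)) /(trig_approximableD au).
by under eq_fun do rewrite mulN1r.
Qed.

Lemma trig_approximable_sum (u : nat -> R -> R) n :
  (forall i, trig_approximable (u i)) ->
  trig_approximable (fun x => \sum_(i < n) u i x).
Proof.
move=> au; elim: n => [|n IH].
  under eq_fun do rewrite big_ord0.
  exact: trig_approximable_trig_real (trig_real_cst 0).
by under eq_fun do rewrite big_ord_recr /=; exact: trig_approximableD.
Qed.

(** Dominated convergence with majorant $(M+N)^2 w$, where [N] bounds the limit, makes the weighted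
    squared distance from [u_ n] to [u] tend to 0; an approximant of a late term then approximates
    [u]. *)
Lemma trig_approximable_lim (u_ : nat -> R -> R) u M :
  (forall n, trig_approximable (u_ n)) ->
  (forall n x, freq x -> `|u_ n x| <= M) ->
  ess_bounded u ->
  {ae mu, forall x, freq x -> u_ ^~ x @ \oo --> u x} ->
  trig_approximable u.
Proof.
move=> au uM bu u_u; split => // e e0.
have cvg0 : I (fun x => (u_ n x - u x) ^+ 2 * w x) @[n --> \oo] --> 0.
  have iw n : integrable (fun x => (u_ n x - u x) ^+ 2 * w x).
    by apply: integrable_sq_dist => //; case: (au n).
  have [mu_ [N uN]] := bu.
  have ig : mu.-integrable (@freq R) (fun x => ((M + N) ^+ 2)%:E * (w x)%:E)%E.
    exact: integrableZl.
  have sq_cvg : {ae mu, forall x, freq x ->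
      ((u_ n x - u x) ^+ 2 * w x)%:E @[n --> \oo] --> 0%E}.
    move: u_u; apply: filterS => x ux fx; apply: cvg_EFin; first exact: nearW.
    have d0 : u_ n x - u x @[n --> \oo] --> 0.
      by rewrite -(subrr (u x)); apply: cvgB; [exact: ux|exact: cvg_cst].
    rewrite -(mul0r (w x)) -(mul0r (0 : R)); apply: cvgMl.
    exact: (cvgM d0 d0).
  have dom : {ae mu, forall x n, freq x ->
      (`|((u_ n x - u x) ^+ 2 * w x)%:E| <= ((M + N) ^+ 2)%:E * (w x)%:E)%E}.
    move: uN; apply: filterS => x ux n fx /=.
    rewrite lee_fin normrM (ger0_norm (w_ge0 fx)) ler_wpM2r ?w_ge0//.
    have uM' : `|u_ n x - u x| <= M + N.
      by apply: le_trans (ler_normB _ _) _; apply: lerD; [exact: uM|exact: ux].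
    by rewrite normrX lerXn2r ?nnegrE// (le_trans _ uM').
  have [_ _] := @dominated_convergence _ _ _ mu _ (@measurable_freq R)
    (fun n x => ((u_ n x - u x) ^+ 2 * w x)%:E) (cst 0%E) _
    (fun n => measurable_int _ (iw n)) (measurable_cst _) sq_cvg ig dom.
  by rewrite integral0 => cvg; apply: fine_cvg.
have [n _ /(_ n (leqnn n)) /=] : \forall n \near \oo,
    I (fun x => (u_ n x - u x) ^+ 2 * w x) < e / 4.
  by apply: (cvgr_lt 0) => //; rewrite divr_gt0.
move=> ne; have [bn /(_ (e / 4))[|p tp pe]] := au n; first by rewrite divr_gt0.
have bp := ess_bounded_trig_real tp.
exists p => //.
pose b x := 2 * ((u_ n x - p x) ^+ 2 * w x) + 2 * ((u_ n x - u x) ^+ 2 * w x).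
have i1 := integrable_sq_dist bn bp; have i2 := integrable_sq_dist bn bu.
have i3 : integrable (fun x => 2 * ((u_ n x - p x) ^+ 2 * w x)).
  exact: (integrableZl _ 2 i1).
have i4 : integrable (fun x => 2 * ((u_ n x - u x) ^+ 2 * w x)).
  exact: (integrableZl _ 2 i2).
apply: (@le_lt_trans _ _ (I b)).
  apply: le_Rintegral => //.
  - exact: integrable_sq_dist.
  - exact: (integrableD _ i3 i4).
  - move=> x fx; rewrite /b !mulrA -mulrDl; apply: ler_wpM2r; first exact: w_ge0.
    (* With $s = u_n - p$ and $t = u_n - u$, this square is the gap in $(s-t)^2 \le 2s^2 + 2t^2$. *)
    by have := sqr_ge0 (u x + p x - 2 * u_ n x); nra.
by rewrite /b RintegralD// !RintegralZl//; exact: two_quarters_lt.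
Qed.

End WeightedApproximation.

(** * Pointwise limits of the step polynomials *)

Section PowerLimits.
Variable R : realType.
Implicit Types (q y : R) (m n : nat).

Lemma bernoulli_ineq y m : 0 <= y <= 1 -> 1 - m%:R * y <= (1 - y) ^+ m.
Proof.
move=> /andP[y0 y1]; elim: m => [|m IH]; first by rewrite mul0r subr0.
rewrite exprS; apply: (@le_trans _ _ ((1 - y) * (1 - m%:R * y))).
  have m0 : 0 <= m%:R :> R by exact: ler0n.
  by rewrite -natr1; nra.
by rewrite ler_wpM2l// subr_ge0.
Qed.

Lemma exprD1_ge y m : 0 <= y -> 1 + m%:R * y <= (1 + y) ^+ m.
Proof.
move=> y0; elim: m => [|m IH]; first by rewrite mul0r addr0.
rewrite exprS; apply: (@le_trans _ _ ((1 + y) * (1 + m%:R * y))).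
  have m0 : 0 <= m%:R :> R by exact: ler0n.
  by rewrite -natr1; nra.
by rewrite ler_wpM2l// addr_ge0.
Qed.

(** Replacing $my$ by the larger $(1+y)^m$ turns the product into $(1-y^2)^m$. *)
Lemma exprB1_mul_le1 y m : 0 <= y <= 1 -> (1 - y) ^+ m * (m%:R * y) <= 1.
Proof.
move=> /andP[y0 y1]; have z0 : 0 <= (1 - y) ^+ m by rewrite exprn_ge0// subr_ge0.
apply: (@le_trans _ _ ((1 - y) ^+ m * (1 + y) ^+ m)).
  by rewrite ler_wpM2l// (le_trans _ (exprD1_ge m y0))// lerDr.
by rewrite -exprMn; apply: exprn_ile1; nra.
Qed.

(** The outer exponent puts the threshold at $q = 1/2$: the behaviour is governed by $2^n q^n =
    (2q)^n$, which tends to 0 below it and to infinity above it. *)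
Definition step_poly q n : R := (1 - q ^+ n) ^+ (2 ^ n).

Lemma step_poly_itv q n : 0 <= q <= 1 -> 0 <= step_poly q n <= 1.
Proof.
move=> /andP[q0 q1]; have := exprn_ge0 n q0; have := exprn_ile1 n q0 q1 => qn1 qn0.
by rewrite /step_poly exprn_ge0 ?exprn_ile1//; lra.
Qed.

(** Bernoulli's inequality squeezes the sequence between $1 - (2q)^n$ and 1. *)
Lemma cvg_step_poly1 q : 0 <= q < 2^-1 -> step_poly q n @[n --> \oo] --> (1 : R).
Proof.
move=> /andP[q0 q2]; have q1 : q <= 1 by lra.
apply: (@squeeze_cvgr _ _ _ _ (fun n => 1 - (2 * q) ^+ n) (fun=> 1)).
- apply: nearW => n.
  have /andP[_ ->] : 0 <= step_poly q n <= 1 by apply: step_poly_itv; rewrite q0.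
  rewrite andbT exprMn; have /(@bernoulli_ineq _ (2 ^ n)) : 0 <= q ^+ n <= 1.
    by rewrite exprn_ge0// exprn_ile1.
  by rewrite natrX.
- rewrite -[X in _ --> X]subr0; apply: cvgB; first exact: cvg_cst.
  by apply: cvg_expr; rewrite ger0_norm; lra.
- exact: cvg_cst.
Qed.

(** [exprB1_mul_le1] at $y = q^n$, $m = 2^n$ bounds the sequence by $(2q)^{-n}$. *)
Lemma cvg_step_poly0 q : 2^-1 < q <= 1 -> step_poly q n @[n --> \oo] --> (0 : R).
Proof.
move=> /andP[q2 q1]; have q0 : 0 < q by lra.
apply: (@squeeze_cvgr _ _ _ _ (fun=> 0) (fun n => (2 * q)^-1 ^+ n)).
- apply: nearW => n.
  have /andP[-> _] : 0 <= step_poly q n <= 1.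
    by apply: step_poly_itv; rewrite q1 ltW.
  rewrite exprVn -[leRHS]mul1r ler_pdivlMr; last by rewrite exprn_gt0// mulr_gt0.
  have /(@exprB1_mul_le1 _ (2 ^ n)) : 0 <= q ^+ n <= 1.
    by rewrite exprn_ge0 ?exprn_ile1// ltW.
  by rewrite exprMn natrX.
- exact: cvg_cst.
- apply: cvg_expr; rewrite ger0_norm ?invr_ge0; last by lra.
  by rewrite invf_lt1; lra.
Qed.

End PowerLimits.

(** * From rays to measurable sets to bounded functions *)

Section BoundedApproximation.
Variables (R : realType) (w : R -> R).
Notation mu := (@lebesgue_measure R).
Hypothesis w_ge0 : forall x, freq x -> 0 <= w x.
Hypothesis w_int : mu.-integrable (@freq R) (EFin \o w).
Implicit Types u v : R -> R.

Lemma trig_approximable_ae u v : trig_approximable w u -> ess_bounded v ->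
  (exists M, forall x, freq x -> `|u x| <= M) ->
  {ae mu, forall x, freq x -> u x = v x} -> trig_approximable w v.
Proof.
move=> au bv [M uM] uv.
(* The constant sequence [u] converges almost everywhere to [v]. *)
apply: (trig_approximable_lim w_ge0 w_int (u_ := fun=> u) (M := M)) => //.
by move: uv; apply: filterS => x uv fx; rewrite -uv//; exact: cvg_cst.
Qed.

Lemma ess_bounded_indic (A : set R) : measurable A -> ess_bounded (\1_A : R -> R).
Proof.
move=> mA; split; first exact/measurable_funTS/measurable_indic.
by exists 1; apply: aeW => x _; rewrite indicE; case: (x \in A); rewrite ?normr1 ?normr0.
Qed.

Lemma ae_neq (c : R) : {ae mu, forall x, x <> c}.
Proof.
exists [set c]; split; [exact: measurable_set1|exact: lebesgue_measure_set1|].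
by move=> x /= /contrapT.
Qed.

Lemma ae_freq_interior : {ae mu, forall x, freq x -> - pi < x < pi}.
Proof.
move: (ae_neq (- pi)) (ae_neq pi); apply: filterS2 => x /eqP x1 /eqP x2 /=.
by rewrite /freq /= in_itv /= => /andP[a b]; rewrite !lt_neqAle a b x2 eq_sym x1.
Qed.

(* On ]-pi, pi[ this has the sign of [x - b], as [cos (x / 2)] is positive there. *)
Lemma sin_half_diff (b x : R) :
  sin (x - b / 2) - sin (b / 2) = 2 * cos (x / 2) * sin ((x - b) / 2).
Proof.
have -> : x - b / 2 = x / 2 + (x - b) / 2 by field.
have -> : b / 2 = x / 2 - (x - b) / 2 by field.
rewrite sinD sinB.
by ring.
Qed.

(** The shift by [b / 2] makes the value 1/2 occur at [b] and at both endpoints of the period; the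
    factor 1/4 keeps the values in $[0,1]$. *)
Definition ray_poly (b x : R) : R := 2^-1 + (sin (x - b / 2) - sin (b / 2)) / 4.

Lemma ray_poly_itv b x : 0 <= ray_poly b x <= 1.
Proof.
rewrite /ray_poly; have := sin_le1 (x - b / 2); have := sin_geN1 (x - b / 2).
by have := sin_le1 (b / 2); have := sin_geN1 (b / 2); lra.
Qed.

Lemma ray_poly_lt b x : - pi < b < pi -> - pi < x < pi -> x < b ->
  ray_poly b x < 2^-1.
Proof.
move=> /andP[b1 b2] /andP[x1 x2] xb.
have c0 : 0 < cos (x / 2) by apply: cos_gt0_pihalf; lra.
have s0 : 0 < sin ((b - x) / 2) by apply: sin_gt0_pi; lra.
rewrite /ray_poly sin_half_diff.
have -> : (x - b) / 2 = - ((b - x) / 2) by field.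
by rewrite sinN; have := mulr_gt0 c0 s0; lra.
Qed.

Lemma ray_poly_gt b x : - pi < b < pi -> - pi < x < pi -> b < x ->
  2^-1 < ray_poly b x.
Proof.
move=> /andP[b1 b2] /andP[x1 x2] xb.
have c0 : 0 < cos (x / 2) by apply: cos_gt0_pihalf; lra.
have s0 : 0 < sin ((x - b) / 2) by apply: sin_gt0_pi; lra.
by rewrite /ray_poly sin_half_diff; have := mulr_gt0 c0 s0; lra.
Qed.

Lemma trig_approximable_ray (b : R) : trig_approximable w (\1_`]-oo, b[ : R -> R).
Proof.
set J : R -> R := \1_`]-oo, b[.
have bI : ess_bounded J by exact: ess_bounded_indic.
have IE x : J x = (x < b)%R%:R.
  by rewrite /J indicE; congr (nat_of_bool _)%:R; rewrite mem_setE in_itv.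
have cst (c : R) : {ae mu, forall x, freq x -> c = J x} ->
    trig_approximable w J.
  apply: trig_approximable_ae => //; last by exists `|c|.
  exact: trig_approximable_trig_real (trig_real_cst c).
(* For [b] outside $(-\pi, \pi)$ the indicator is almost everywhere constant on [freq]. *)
have [b1|b1] := leP b (- pi).
  apply: (cst 0); move: ae_freq_interior; apply: filterS => x + fx.
  by rewrite IE => /(_ fx)/andP[x1 _]; rewrite ltNge (le_trans b1 (ltW x1)).
have [b2|b2] := leP pi b.
  apply: (cst 1); move: ae_freq_interior; apply: filterS => x + fx.
  by rewrite IE => /(_ fx)/andP[_ x2]; rewrite (lt_le_trans x2 b2).
have bpi : - pi < b < pi by rewrite b1 b2.
apply: (trig_approximable_lim w_ge0 w_int
  (u_ := fun n x => step_poly (ray_poly b x) n) (M := 1)) => //.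
- move=> n; apply: trig_approximable_trig_real => //; apply: trig_realX.
  apply: trig_realB; first exact: trig_real_cst.
  apply: trig_realX; apply: trig_realD; first exact: trig_real_cst.
  apply: trig_realM; last exact: trig_real_cst.
  by apply: trig_realB; [exact: trig_real_sinB|exact: trig_real_cst].
- move=> n x _; have /andP[h0 h1] := step_poly_itv n (ray_poly_itv b x).
  by rewrite ger0_norm.
(* The null set left out consists of [b] and $\pm\pi$, where [ray_poly] takes the threshold value
   1/2. *)
- move: ae_freq_interior (ae_neq b); apply: filterS2 => x xpi /eqP xb fx.
  rewrite IE; have := xpi fx => {}xpi; have /andP[q0 q1] := ray_poly_itv b x.
  case: ltgtP xb => // xb _.
    by apply: cvg_step_poly1; rewrite q0 ray_poly_lt.
  by apply: cvg_step_poly0; rewrite q1 ray_poly_gt.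
Qed.

(** The open left rays form a pi-system generating the Borel sets, and the approximable sets form a
    Dynkin class: complements by subtraction from 1, disjoint unions as bounded limits of partial
    sums. *)
Lemma trig_approximable_indic (A : set R) : measurable A ->
  trig_approximable w (\1_A : R -> R).
Proof.
move=> mA; have {mA} : (@RGenInftyO.G R).-sigma.-measurable A.
  by rewrite -RGenInftyO.measurableE.
apply: (@dynkin_induction _ _ (@RGenInftyO.G R)
  (fun A => trig_approximable w (\1_A : R -> R))).
- exact: RGenInftyO.measurableE.
- move=> _ _ [a ->] [b ->]; exists (Num.min a b).
  by apply/seteqP; split => x /=; rewrite !in_itv /= lt_min => /andP.
- by rewrite indicT; exact: trig_approximable_trig_real (trig_real_cst 1).
- by move=> _ [b ->]; exact: trig_approximable_ray.
- move=> S mS aS.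
  have -> : \1_(~` S) = (fun x => 1 - \1_S x) :> (R -> R).
    by rewrite indicC; apply/funext => x; rewrite indicE; case: (x \in S);
      rewrite /= ?subrr ?subr0.
  apply: trig_approximableB => //.
  exact: trig_approximable_trig_real (trig_real_cst 1).
- move=> F mF tF aF.
  (* By disjointness at most one [F k] contains [x], so a partial sum is 0 or 1, and it is 1 exactly
     when that [k] exists and lies below [n]. This gives both the uniform bound and the limit. *)
  have sumE n x : \sum_(i < n) \1_(F i) x =
      ((if pselect (exists k, F k x) is left kx
        then (sval (cid kx) < n)%N else false) : bool)%:R :> R.
    case: pselect => [kx|nk].
      case: cid => /= k Fkx; elim: n => [|n IH]; first by rewrite big_ord0.
      rewrite big_ord_recr /= IH indicE ltnS (leq_eqVlt k n).
      have [<-|kn] := eqVneq k n; first by rewrite ltnn mem_set// add0r.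
      rewrite memNset ?addr0// => Fnx; move/eqP: kn; apply.
      by apply: tF => //; exists x.
    rewrite big1// => i _; rewrite indicE memNset// => Fix; apply: nk.
    by exists i.
  apply: (trig_approximable_lim w_ge0 w_int
    (u_ := fun n x => \sum_(i < n) \1_(F i) x) (M := 1)) => //.
  + by move=> n; apply: (trig_approximable_sum w_ge0 w_int (u := fun i => \1_(F i) : R -> R)).
  + by move=> n x _; rewrite sumE normr_nat lern1 leq_b1.
  + by apply: ess_bounded_indic; exact: bigcup_measurable.
  + apply: aeW => x _; under eq_fun do rewrite sumE.
    case: pselect => [kx|nk].
      case: cid => /= k Fkx; rewrite indicE mem_set; last by exists k.
      apply: cvg_near_cst; exists k.+1 => // n /= kn.
      by rewrite kn.
    rewrite indicE memNset; first exact: cvg_cst.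
    by move=> [k _ Fkx]; apply: nk; exists k.
Qed.

(** Counts the layers that contain a given point in the layer-cake sum below. *)
Lemma sum_ltn_minn (m t : nat) : \sum_(k < m) (k < t)%:R = (minn m t)%:R :> R.
Proof.
elim: m => [|m IH]; first by rewrite big_ord0 min0n.
rewrite big_ord_recr /= IH -natrD; congr _%:R.
by case: ltnP => mt; [rewrite (minn_idPl mt) addn1|
  rewrite (minn_idPr (leqW mt)) addn0].
Qed.

Lemma trig_approximable_unit_interval u : measurable_fun (@freq R) u ->
  (forall x, freq x -> 0 <= u x <= 1) -> trig_approximable w u.
Proof.
move=> mu_ u01.
(* Layer-cake decomposition: the average of the indicators of these superlevel sets is [u] rounded
   down to a multiple of $1/(n+1)$. *)
pose A n k : set R := @freq R `&` [set x | (k.+1)%:R / n.+1%:R <= u x].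
pose s n x : R := n.+1%:R^-1 * \sum_(k < n.+1) \1_(A n k) x.
have AE n k x : freq x -> \1_(A n k) x = (k < Num.truncn (n.+1%:R * u x))%:R :> R.
  move=> fx; rewrite indicE truncn_gt_nat mulrC -ler_pdivrMr ?ltr0n//.
  congr (nat_of_bool _)%:R; apply/idP/idP; first by rewrite inE => -[].
  by move=> h; rewrite inE.
have sE n x : freq x -> s n x = n.+1%:R^-1 * (Num.truncn (n.+1%:R * u x))%:R.
  move=> fx; rewrite /s; congr (_ * _).
  under eq_bigr do rewrite AE//.
  (* As $u \le 1$, the integer part is at most $n+1$, so the $n+1$ layers count all of it. *)
  rewrite sum_ltn_minn (minn_idPr _)//.
  have /andP[u0 u1] := u01 x fx; rewrite -ltnS truncn_lt_nat ?mulr_ge0//.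
  by rewrite (@le_lt_trans _ _ (n.+1%:R * 1)) ?ler_wpM2l// mulr1 ltr_nat.
have sbd n x : freq x -> u x - n.+1%:R^-1 <= s n x <= u x.
  move=> fx; rewrite sE//; have /andP[u0 u1] := u01 x fx.
  have nu0 : 0 <= n.+1%:R * u x by rewrite mulr_ge0.
  have /andP[t1 t2] := truncn_itv nu0.
  rewrite ler_pdivrMl ?ltr0n// t1 andbT ler_pdivlMl ?ltr0n//.
  by rewrite mulrBr divff ?pnatr_eq0// lerBlDr natr1 ltW.
apply: (trig_approximable_lim w_ge0 w_int (u_ := s) (M := 1)) => //.
- move=> n; apply: trig_approximableZ => //.
  apply: (trig_approximable_sum w_ge0 w_int (u := fun k => \1_(A n k) : R -> R)) => k.
  by apply: trig_approximable_indic; rewrite /A -preimage_itvcy; apply: mu_.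
- move=> n x fx; rewrite ger0_norm.
    by have /andP[_ h] := sbd n x fx; rewrite (le_trans h)//; case/andP: (u01 x fx).
  by rewrite sE// mulr_ge0.
- split => //; exists 1; apply: aeW => x fx; have /andP[u0 u1] := u01 x fx.
  by rewrite ger0_norm.
- apply: aeW => x fx.
  apply: (@squeeze_cvgr _ _ _ _ (fun n => u x - n.+1%:R^-1) (fun=> u x)).
  + by apply: nearW => n; exact: sbd.
  + rewrite -[X in _ --> X]subr0; apply: cvgB; first exact: cvg_cst.
    exact: cvg_harmonic.
  + exact: cvg_cst.
Qed.

Lemma trig_approximable_ess_bounded u : ess_bounded u -> trig_approximable w u.
Proof.
move=> bu; have [mu_ [M uM]] := bu.
pose K := `|M| + 1; have K0 : 0 < K by rewrite ltr_wpDl.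
(* $[-K,K]$ is mapped affinely onto $[0,1]$. The truncation puts the values in $[0,1]$ everywhere,
   although [M] bounds [u] only almost everywhere. *)
pose v x := Num.max 0 (Num.min 1 ((2 * K)^-1 * u x + 2^-1)).
have v01 x : 0 <= v x <= 1.
  by rewrite /v le_max lexx /= ge_max ler01 /= ge_min lexx.
have av : trig_approximable w v.
  apply: trig_approximable_unit_interval => //.
  apply: measurable_maxr; first exact: measurable_cst.
  apply: measurable_minr; first exact: measurable_cst.
  apply: measurable_funD; last exact: measurable_cst.
  by apply: measurable_funM => //; exact: measurable_cst.
apply: (@trig_approximable_ae (fun x => 2 * K * v x - K)) => //.
- apply: trig_approximableB => //; first exact: trig_approximableZ.
  exact: trig_approximable_trig_real (trig_real_cst K).
- exists (2 * K + K) => x _; apply: le_trans (ler_normB _ _) _.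
  have /andP[v0 v1] := v01 x.
  by rewrite (gtr0_norm K0) lerD2r ger0_norm; nra.
- move: uM; apply: filterS => x uM fx.
  have uK : `|u x| <= K.
    by apply: le_trans (uM fx) _; rewrite (le_trans (ler_norm M))// lerDl.
  have -> : v x = (2 * K)^-1 * u x + 2^-1.
    have [] : - 2^-1 <= (2 * K)^-1 * u x /\ (2 * K)^-1 * u x <= 2^-1.
      move: uK; rewrite ler_norml => /andP[h1 h2]; split.
        by rewrite ler_pdivlMl; lra.
      by rewrite ler_pdivrMl; lra.
    move=> h1 h2; rewrite /v min_r ?max_r//; lra.
  by field; lra.
Qed.

End BoundedApproximation.

(** * Componentwise complex integration and orthogonality of exponentials *)

Section ComplexIntegral.
Variable R : realType.
Notation mu := (@lebesgue_measure R).
Notation integrable u := (mu.-integrable (@freq R) (EFin \o u)).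
Implicit Types (z t c : R[i]) (g h : R -> R[i]) (u v : R -> R).

Lemma cabs_ge0 z : 0 <= cabs z.
Proof. by case: z => a b; exact: sqrtr_ge0. Qed.

Lemma cabs_sq z : cabs z ^+ 2 = complex.Re z ^+ 2 + complex.Im z ^+ 2.
Proof. by case: z => a b; rewrite sqr_sqrtr// addr_ge0 ?sqr_ge0. Qed.

Lemma cabs_sqC z : (cabs z ^+ 2)%:C = z * (z^*)%R.
Proof.
rewrite cabs_sq; case: z => a b; apply/eqP; rewrite eq_complex /=.
by apply/andP; split; apply/eqP; ring.
Qed.

Lemma cabsM z t : cabs (z * t) = cabs z * cabs t.
Proof. exact: Normc.normcM. Qed.

Lemma cabs_expi j x : cabs (expi j x : R[i]) = 1.
Proof. by rewrite /cabs /expi /= cos2Dsin2 sqrtr1. Qed.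

Lemma cabs_real (a : R) : cabs a%:C = `|a|.
Proof. by rewrite /cabs /= expr0n addr0 sqrtr_sqr. Qed.

Lemma cabs_sum_le (I : Type) (s : seq I) (F : I -> R[i]) (r : R) :
  (forall i, cabs (F i) <= r) -> cabs (\sum_(i <- s) F i) <= (size s)%:R * r.
Proof.
move=> Fr; elim: s => [|i s IH].
  by rewrite big_nil mul0r -[0 in X in cabs X]/(0%:C) cabs_real normr0.
rewrite big_cons; apply: le_trans (complex.le_normcD _ _) _.
by rewrite -natr1 mulrDl mul1r addrC lerD//; exact: Fr.
Qed.

Lemma cabs_sqD_le z t : cabs (z + t) ^+ 2 <= 2 * cabs z ^+ 2 + 2 * cabs t ^+ 2.
Proof.
rewrite !cabs_sq !raddfD /=.
have := sqr_ge0 (complex.Re z - complex.Re t).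
by have := sqr_ge0 (complex.Im z - complex.Im t); nra.
Qed.

Lemma ess_bounded_cabs_sq h : ess_cbounded h ->
  ess_bounded (fun x => cabs (h x) ^+ 2).
Proof.
move=> [h1 h2]; under eq_fun do rewrite cabs_sq.
by apply: ess_boundedD; exact: ess_boundedX.
Qed.

Definition cintegrable h : Prop :=
  integrable (fun x => complex.Re (h x)) /\ integrable (fun x => complex.Im (h x)).

Lemma cintegrable_ess_cbounded h : ess_cbounded h -> cintegrable h.
Proof. by move=> [h1 h2]; split; exact: integrable_ess_bounded. Qed.

Lemma integrableDR u v : integrable u -> integrable v ->
  integrable (fun x => u x + v x).
Proof. by move=> iu iv; exact: (integrableD _ iu iv). Qed.

Lemma integrableBR u v : integrable u -> integrable v ->
  integrable (fun x => u x - v x).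
Proof. by move=> iu iv; exact: (integrableB _ iu iv). Qed.

Lemma integrableZR (a : R) u : integrable u -> integrable (fun x => a * u x).
Proof. by move=> iu; exact: (integrableZl _ a iu). Qed.

Lemma cintegrableD g h : cintegrable g -> cintegrable h ->
  cintegrable (fun x => g x + h x).
Proof.
move=> [g1 g2] [h1 h2]; split.
  by under [X in _ \o X]eq_fun do rewrite raddfD; exact: integrableDR.
by under [X in _ \o X]eq_fun do rewrite raddfD; exact: integrableDR.
Qed.

Lemma cintegrableM_ess_cbounded g h : ess_cbounded g -> cintegrable h ->
  cintegrable (fun x => g x * h x).
Proof.
move=> [g1 g2] [h1 h2]; split.
  under [X in _ \o X]eq_fun do rewrite ReM.
  by apply: integrableBR; exact: integrableM_ess_bounded.
under [X in _ \o X]eq_fun do rewrite ImM.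
by apply: integrableDR; exact: integrableM_ess_bounded.
Qed.

Lemma cintegrableZ c h : cintegrable h -> cintegrable (fun x => c * h x).
Proof. exact: cintegrableM_ess_cbounded (ess_cbounded_cst c). Qed.

Lemma cintegrable_sum (I : Type) (s : seq I) (F : I -> R -> R[i]) :
  (forall i, cintegrable (F i)) -> cintegrable (fun x => \sum_(i <- s) F i x).
Proof.
move=> iF; elim: s => [|i s IH].
  under eq_fun do rewrite big_nil.
  exact: cintegrable_ess_cbounded (ess_cbounded_cst 0).
by under eq_fun do rewrite big_cons; exact: cintegrableD.
Qed.

Lemma cintegralD g h : cintegrable g -> cintegrable h ->
  cintegral (fun x => g x + h x) = cintegral g + cintegral h.
Proof.
move=> [g1 g2] [h1 h2]; rewrite /cintegral; apply/eqP; rewrite eq_complex /=.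
by under eq_Rintegral do rewrite raddfD;
   under [X in _ && (X == _)]eq_Rintegral do rewrite raddfD;
   rewrite !RintegralD// !eqxx.
Qed.

Lemma cintegralZ c h : cintegrable h ->
  cintegral (fun x => c * h x) = c * cintegral h.
Proof.
move=> [h1 h2]; rewrite /cintegral; apply/eqP; rewrite eq_complex ReM ImM /=.
under eq_Rintegral do rewrite ReM.
under [X in _ && (X == _)]eq_Rintegral do rewrite ImM.
by rewrite RintegralB// ?RintegralD// ?RintegralZl// ?eqxx//; exact: integrableZR.
Qed.

Lemma cintegral0 : cintegral (fun=> 0) = 0 :> R[i].
Proof.
have := cintegralZ 0 (cintegrable_ess_cbounded (ess_cbounded_cst 0)).
by rewrite !mul0r.
Qed.

Lemma cintegral_sum (I : Type) (s : seq I) (F : I -> R -> R[i]) :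
  (forall i, cintegrable (F i)) ->
  cintegral (fun x => \sum_(i <- s) F i x) = \sum_(i <- s) cintegral (F i).
Proof.
move=> iF; elim: s => [|i s IH].
  by under eq_fun do rewrite big_nil; rewrite big_nil cintegral0.
under eq_fun do rewrite big_cons.
by rewrite cintegralD ?IH ?big_cons//; exact: cintegrable_sum.
Qed.

Lemma cintegral_real u : cintegral (fun x => (u x)%:C) =
  (Rintegral mu (@freq R) u)%:C.
Proof.
rewrite /cintegral /=; congr (_ +i* _).
by rewrite /Rintegral integral0.
Qed.

Lemma Rintegral_freq_cst (c : R) : \int[mu]_(x in @freq R) c = c * (2 * pi).
Proof.
have pi0 := pi_gt0 R.
rewrite Rintegral_cst//; congr (_ * _).
transitivity (fine (mu (`[- pi, pi] : set R))) => //; rewrite lebesgue_measure_itv /=.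
by rewrite lte_fin ifT -?EFinB /=; lra.
Qed.

(** Cauchy-Schwarz against the constant 1, from the nonnegativity of the integral of $(u-s)^2$. *)
Lemma Rintegral_sq_le u : ess_bounded u ->
  (Rintegral mu (@freq R) u) ^+ 2 <= 2 * pi * \int[mu]_(x in @freq R) u x ^+ 2.
Proof.
move=> bu; set A := Rintegral mu _ u; set B := \int[mu]_(x in _) _.
(* The mean of [u] is the constant that minimizes the integral of $(u-s)^2$, hence gives the sharp
   bound. *)
have pi0 := pi_gt0 R; pose s := A / (2 * pi).
have i1 : integrable u by exact: integrable_ess_bounded.
have i2 : integrable (fun x => u x ^+ 2).
  by apply: integrable_ess_bounded; exact: ess_boundedX.
have ic (c : R) : integrable (fun=> c).
  by apply: integrable_ess_bounded; exact: ess_bounded_cst.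
have : \int[mu]_(x in @freq R) (2 * s * u x) <=
       \int[mu]_(x in @freq R) (u x ^+ 2 + s ^+ 2).
  apply: le_Rintegral => //; first exact: integrableZR.
    exact: integrableDR.
  by move=> x _; have := sqr_ge0 (u x - s); rewrite sqrrB -mulr_natr; lra.
rewrite RintegralZl// RintegralD// Rintegral_freq_cst -/A -/B.
have -> : A = s * (2 * pi) by rewrite /s; field; lra.
by move: pi0; clear; move: (pi : R) => p p0; nra.
Qed.

Lemma cabs_sq_cintegral_le h : ess_cbounded h ->
  cabs (cintegral h) ^+ 2 <= 2 * pi * \int[mu]_(x in @freq R) (cabs (h x) ^+ 2).
Proof.
move=> [h1 h2]; rewrite cabs_sq /=.
under [in leRHS]eq_Rintegral do rewrite cabs_sq.
rewrite RintegralD//; last 2 first.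
- by apply: integrable_ess_bounded; exact: ess_boundedX.
- by apply: integrable_ess_bounded; exact: ess_boundedX.
by rewrite mulrDr lerD//; exact: Rintegral_sq_le.
Qed.

Lemma cintegral_expi (j : int) : cintegral (@expi R j) = ((2 * pi) * (j == 0)%:R)%:C.
Proof.
have pi0 := pi_gt0 R.
have [->|j0] := eqVneq j 0.
  rewrite mulr1 -[2 * pi]mul1r -Rintegral_freq_cst -cintegral_real.
  by congr cintegral; apply/funext => x; rewrite expi0.
have jR0 : j%:~R != 0 :> R by rewrite intr_eq0.
rewrite mulr0.
(* A continuous function with an antiderivative of equal values at $\pm\pi$ has integral 0. For the
   sine the antiderivative is even; for the cosine it vanishes at both ends because $\sin(j\pi) =
   0$. *)
have FTC (f F : R -> R) : continuous f ->
    (forall x : R, is_derive x 1 F (f x)) -> F pi = F (- pi) ->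
    \int[mu]_(x in @freq R) f x = 0.
  move=> cf dF FF; rewrite /Rintegral (continuous_FTC2 (F := F)).
  - by rewrite FF subee.
  - by lra.
  - exact: continuous_subspaceT.
  - have cF x : {for x, continuous F}.
      by apply: differentiable_continuous; apply/derivable1_diffP; case: (dF x).
    split; first by move=> x _; case: (dF x).
      by apply: cvg_at_right_filter; exact: cF.
    by apply: cvg_at_left_filter; exact: cF.
  - by move=> x _; rewrite derive1E; case: (dF x).
have sin_jpi : sin (j%:~R * pi) = 0 :> R.
  have sn (n : nat) : sin (n%:R * pi) = 0 :> R.
    elim: n => [|n IH]; first by rewrite mul0r sin0.
    by rewrite -natr1 mulrDl mul1r sinDpi IH oppr0.
  by case: j {j0 jR0} => n; rewrite ?NegzE ?mulrNz ?mulNr ?sinN sn ?oppr0.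
rewrite /cintegral; congr (_ +i* _) => /=.
- apply: (FTC _ (fun x => j%:~R^-1 * sin (j%:~R * x))).
  + move=> x; apply: continuous_comp; last exact: continuous_cos.
    by apply: cvgM; [exact: cvg_cst|exact: cvg_id].
  + move=> x; apply: is_derive_eq; rewrite /GRing.scale /=.
    by field.
  + by rewrite mulrN sinN sin_jpi oppr0.
- apply: (FTC _ (fun x => - (j%:~R^-1 * cos (j%:~R * x)))).
  + move=> x; apply: continuous_comp; last exact: continuous_sin.
    by apply: cvgM; [exact: cvg_cst|exact: cvg_id].
  + move=> x; apply: is_derive_eq; rewrite /GRing.scale /=.
    by field.
  + by rewrite mulrN cosN.
Qed.

End ComplexIntegral.

(** * Fourier coefficients, density and the observed frequencies *)

Section ObservedSpan.
Variable R : realType.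
Notation mu := (@lebesgue_measure R).
Notation integrable u := (mu.-integrable (@freq R) (EFin \o u)).
Implicit Types (f w : R -> R) (g h : R -> R[i]) (l : seq (R[i] * int)).

(** Orthogonality of the exponentials; the coefficients of a repeated frequency add up. *)
Lemma fourier_trig_sum l (k : int) :
  cintegral (fun x => trig_sum l x * expi (- k) x) =
  (2 * pi)%:C * \sum_(t <- l | t.2 == k) t.1.
Proof.
have iE c (j : int) : cintegrable (fun x : R => c * expi j x).
  by apply/cintegrableZ/cintegrable_ess_cbounded; exact: ess_cbounded_expi.
transitivity (cintegral (fun x : R => \sum_(t <- l) t.1 * expi (t.2 - k) x)).
  congr cintegral; apply/funext => x; rewrite /trig_sum mulr_suml.
  by apply: eq_bigr => t _; rewrite -mulrA -expiD.
rewrite cintegral_sum; last by move=> t; exact: iE.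
rewrite mulr_sumr [RHS]big_mkcond; apply: eq_bigr => t _.
rewrite cintegralZ; last first.
  by apply: cintegrable_ess_cbounded; exact: ess_cbounded_expi.
rewrite cintegral_expi subr_eq0 mulrC.
by case: eqP => _; rewrite ?mulr1 ?mulr0 ?mul0r.
Qed.

Lemma trig_sum_dense w h (e : R) : (forall x, freq x -> 0 <= w x) ->
  integrable w -> ess_cbounded h -> 0 < e -> exists l,
  \int[mu]_(x in @freq R) (cabs (h x - trig_sum l x) ^+ 2 * w x) < e.
Proof.
move=> w0 iw [h1 h2] e0; have e2 : 0 < e / 2 by rewrite divr_gt0.
have [_ /(_ _ e2)[p1 t1 pe1]] := trig_approximable_ess_bounded w0 iw h1.
have [_ /(_ _ e2)[p2 t2 pe2]] := trig_approximable_ess_bounded w0 iw h2.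
have b1 := ess_bounded_trig_real t1; have b2 := ess_bounded_trig_real t2.
have [l1 lE1] := t1; have [l2 lE2] := t2.
(* The approximant is $p_1 + i p_2$; its squared error is the sum of those of the real and imaginary
   parts. *)
exists (l1 ++ [seq ((0 +i* 1) * t.1, t.2) | t <- l2]).
have -> : (fun x => cabs (h x -
    trig_sum (l1 ++ [seq ((0 +i* 1) * t.1, t.2) | t <- l2]) x) ^+ 2 * w x) =
    (fun x => (complex.Re (h x) - p1 x) ^+ 2 * w x +
              (complex.Im (h x) - p2 x) ^+ 2 * w x).
  apply/funext => x; rewrite -mulrDl; congr (_ * _).
  rewrite /trig_sum big_cat big_map /=.
  under [X in cabs (_ - (_ + X))]eq_bigr do rewrite -mulrA.
  rewrite -mulr_sumr -/(trig_sum l1 x) -/(trig_sum l2 x) -lE1 -lE2 cabs_sq.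
  by case: (h x) => a b /=; congr (_ ^+ 2 + _ ^+ 2); ring.
rewrite RintegralD//; last 2 first.
- exact: integrable_sq_dist.
- exact: integrable_sq_dist.
by rewrite [e]splitr ltrD.
Qed.

Lemma in_span_observed N l :
  in_span N (trig_sum [seq t <- l | observed N t.2]).
Proof.
set m := [seq t <- l | _].
(* Coefficients of equal frequencies are grouped; [undup] makes each group count once. *)
exists (undup (map snd m)), (fun j => \sum_(t <- m | t.2 == j) t.1); split.
  apply/allP => j; rewrite mem_undup => /mapP[t]; rewrite mem_filter.
  by move=> /andP[+ _] ->.
apply/funext => x; rewrite /trig_sum.
under [RHS]eq_bigr do rewrite mulr_suml.
rewrite (exchange_big_dep predT)//= big_seq [RHS]big_seq.
apply: eq_bigr => t tm.
have tu : t.2 \in undup (map snd m) by rewrite mem_undup map_f.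
rewrite big_mkcond (bigD1_seq _ tu (undup_uniq _)) /= eqxx.
by rewrite big1 ?addr0// => j; rewrite eq_sym => /negPf ->.
Qed.

Lemma unobserved_sum N l (x : R) :
  trig_sum l x - trig_sum [seq t <- l | observed N t.2] x =
  \sum_(k < N.+1) (\sum_(t <- l | t.2 == k%:Z) t.1) * expi k x.
Proof.
rewrite /trig_sum big_filter (bigID (fun t => observed N t.2)) /= addrC addrK.
under [RHS]eq_bigr do rewrite mulr_suml.
rewrite (exchange_big_dep (fun t => ~~ observed N t.2)) /=; last first.
  move=> k t _ /eqP ->; rewrite /observed negb_or -!leNgt !lez_nat leq0n.
  by rewrite -ltnS ltn_ord.
apply: eq_bigr => t; rewrite /observed negb_or -!leNgt => /andP[].
case: t => c [n|//] /= _; rewrite lez_nat -ltnS => nN.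
by rewrite (big_pred1 (Ordinal nN))// => k; rewrite /= -val_eqE eqz_nat eq_sym.
Qed.

Lemma L2dist_ess_cbounded f g h : integrable f -> ess_cbounded g ->
  ess_cbounded h ->
  L2dist f g h =
  ((2 * pi)^-1 * \int[mu]_(x in @freq R) (cabs (g x - h x) ^+ 2 * f x))%:E.
Proof.
move=> if_ bg bh; rewrite /L2dist EFinM /Rintegral fineK//.
apply: integrable_fin_num => //.
apply: integrableM_ess_bounded => //.
by apply: ess_bounded_cabs_sq; exact: ess_cboundedB.
Qed.

Lemma ess_cbounded_L2 f h : integrable f -> ess_cbounded h -> L2 f h.
Proof.
move=> if_ bh; split; first by case: bh => -[? _] [? _].
by rewrite L2dist_ess_cbounded ?ltry//; exact: ess_cbounded_cst.
Qed.

(** Error budget for dropping [n] coefficients of modulus at most $\sqrt{r_2}$ when the weight has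
    integral [K]: the total is at most $d\,r_2 = e/2$. *)
Lemma sq_combination_lt (K e n A B r2 : R) : 0 <= K -> 0 < e -> 0 <= n ->
  r2 = e / (2 * (2 + 2 * n ^+ 2 * K)) -> A <= r2 ->
  2 * A + 2 * (n ^+ 2 * r2) * K < e.
Proof.
move=> K0 e0 n0 -> Ar; set d := 2 + 2 * n ^+ 2 * K in Ar *.
have d0 : 0 < d.
  by rewrite /d ltr_wpDr// mulr_ge0// mulr_ge0// sqr_ge0.
apply: (@le_lt_trans _ _ (d * (e / (2 * d)))); first by rewrite /d in Ar *; lra.
have -> : d * (e / (2 * d)) = e / 2 by field; lra.
by lra.
Qed.

End ObservedSpan.

(** * Membership in $L_2^N(f)$ from vanishing Fourier coefficients *)

Section FourierCharacterization.
Variable R : realType.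
Notation mu := (@lebesgue_measure R).
Notation integrable u := (mu.-integrable (@freq R) (EFin \o u)).
Implicit Types (f w : R -> R) (g h : R -> R[i]).

(** Used with $p = \pi$: the unnormalized coefficient carries a factor $2\pi$, and the
    Cauchy-Schwarz bound only one factor $2\pi$ outside the integral. *)
Lemma coef_sq_le (p r2 A z2 : R) : 1 <= p -> 0 <= z2 -> A <= r2 ->
  (2 * p) ^+ 2 * z2 <= 2 * p * A -> z2 <= r2.
Proof.
move=> p1 z0 Ar; rewrite expr2 -mulrA ler_pM2l ?mulr_gt0//; last by lra.
by move=> h; have := le_trans h Ar => zr; nra.
Qed.

Lemma inv2pi_le1 (X : R) : 0 <= X -> (2 * pi)^-1 * X <= X.
Proof.
move=> X0; rewrite ler_piMl// invf_le1; last by rewrite mulr_gt0// pi_gt0.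
by have := pi_ge2 R; lra.
Qed.

(* Under the weight [f + 1] a trigonometric polynomial close to [h] has Fourier
   coefficients of index [0..N] close to those of [h], so they can be dropped. *)
Lemma L2N_fourier0 N f h : spectral_density f -> ess_cbounded h ->
  (forall k : 'I_N.+1, cintegral (fun x => h x * expi (- k%:Z) x) = 0) ->
  L2N N f h.
Proof.
move=> [f0 if_] bh h0; split; first exact: ess_cbounded_L2.
move=> e e0; set K := Rintegral mu (@freq R) f.
have K0 : 0 <= K by exact: Rintegral_ge0.
pose r2 : R := e / (2 * (2 + 2 * (N.+1)%:R ^+ 2 * K)).
have r20 : 0 < r2.
  apply: divr_gt0 => //; apply: mulr_gt0 => //; apply: ltr_wpDr => //.
  by rewrite !mulr_ge0 ?sqr_ge0.
pose w x := f x + 1.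
have iw : integrable w by apply: integrableDR => //; exact: integrable_cst.
have w0 x : freq x -> 0 <= w x by move=> fx; rewrite addr_ge0// f0.
have [l lh] := trig_sum_dense w0 iw bh r20.
set m := [seq t <- l | observed N t.2].
have bl := ess_cbounded_trig_sum l; have bm := ess_cbounded_trig_sum m.
have bhl := ess_cboundedB bh bl; have bsq := ess_bounded_cabs_sq bhl.
have sq0 x : 0 <= cabs (h x - trig_sum l x) ^+ 2 :> R by exact: sqr_ge0.
have isw : integrable (fun x => cabs (h x - trig_sum l x) ^+ 2 * w x).
  exact: integrableM_ess_bounded.
have isf : integrable (fun x => cabs (h x - trig_sum l x) ^+ 2 * f x).
  exact: integrableM_ess_bounded.
have A1 : \int[mu]_(x in @freq R) (cabs (h x - trig_sum l x) ^+ 2) <= r2.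
  apply: le_trans _ (ltW lh); apply: le_Rintegral => //.
    exact: integrable_ess_bounded.
  by move=> x fx; rewrite ler_peMr ?sq0// /w lerDr f0.
have A2 : \int[mu]_(x in @freq R) (cabs (h x - trig_sum l x) ^+ 2 * f x) <= r2.
  apply: le_trans _ (ltW lh); apply: le_Rintegral => //.
  by move=> x fx; rewrite ler_wpM2l ?sq0// /w lerDl.
pose c (k : 'I_N.+1) := \sum_(t <- l | t.2 == k%:Z) t.1.
have cE k : cabs (c k) <= Num.sqrt r2.
  rewrite -(ler_pXn2r (ltn0Sn 1)) ?nnegrE ?cabs_ge0 ?sqrtr_ge0//.
  rewrite sqr_sqrtr ?(ltW r20)//.
  (* The coefficients of [h] vanish, so those of the polynomial are minus those of the error, which
     is small in unweighted $L_2$. *)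
  have fk : (2 * pi)%:C * c k = - cintegral (fun x =>
      (h x - trig_sum l x) * expi (- k%:Z) x).
    rewrite -fourier_trig_sum; apply/eqP; rewrite -addr_eq0 -cintegralD; last first.
    - by apply: cintegrable_ess_cbounded; apply: ess_cboundedM => //;
        exact: ess_cbounded_expi.
    - by apply: cintegrable_ess_cbounded; apply: ess_cboundedM => //;
        exact: ess_cbounded_expi.
    rewrite -(h0 k); apply/eqP; congr cintegral; apply/funext => x.
    by rewrite -mulrDl addrC subrK.
  have := cabs_sq_cintegral_le (ess_cboundedM bhl (ess_cbounded_expi R (- k%:Z))).
  have -> : (fun x => cabs ((h x - trig_sum l x) * expi (- k%:Z) x) ^+ 2) =
            (fun x => cabs (h x - trig_sum l x) ^+ 2).
    by apply/funext => x; rewrite cabsM cabs_expi mulr1.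
  rewrite -[cintegral _]opprK -fk /cabs complex.normcN -/(cabs _) cabsM exprMn.
  rewrite cabs_real real_normK ?num_real//; apply: coef_sq_le; rewrite ?sqr_ge0//.
  by have := pi_ge2 R; lra.
exists (trig_sum m); first exact: in_span_observed.
rewrite L2dist_ess_cbounded// lte_fin.
(* The second summand comes from the dropped part, which has [N.+1] terms of modulus at most
   $\sqrt{r_2}$. *)
pose b x := 2 * (cabs (h x - trig_sum l x) ^+ 2 * f x) +
  2 * ((N.+1)%:R ^+ 2 * r2) * f x.
have ibf1 : integrable (fun x => 2 * (cabs (h x - trig_sum l x) ^+ 2 * f x)).
  exact: integrableZR.
have ibf2 : integrable (fun x => 2 * ((N.+1)%:R ^+ 2 * r2) * f x).
  exact: integrableZR.
apply: (@le_lt_trans _ _ (Rintegral mu (@freq R) b)).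
  apply: (@le_trans _ _ (\int[mu]_(x in @freq R) (cabs (h x - trig_sum m x) ^+ 2 * f x))).
    by apply/inv2pi_le1/Rintegral_ge0 => x fx; rewrite mulr_ge0 ?sqr_ge0// f0.
  apply: le_Rintegral => //.
  - apply: integrableM_ess_bounded => //; apply: ess_bounded_cabs_sq.
    exact: ess_cboundedB.
  - exact: integrableDR.
  move=> x fx; rewrite /b mulrA -mulrDl ler_wpM2r ?f0//.
  have -> : h x - trig_sum m x =
      (h x - trig_sum l x) + (trig_sum l x - trig_sum m x) by rewrite addrA subrK.
  apply: le_trans (cabs_sqD_le _ _) _; rewrite lerD2l ler_wpM2l//.
  rewrite unobserved_sum -[r2 in leRHS]sqr_sqrtr ?(ltW r20)// -exprMn.
  rewrite lerXn2r ?nnegrE ?cabs_ge0 ?mulr_ge0 ?sqrtr_ge0//.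
  have -> : (N.+1)%:R = (size (index_enum 'I_N.+1))%:R :> R.
    by rewrite -[index_enum _]enumT size_enum_ord.
  apply: cabs_sum_le => k; rewrite cabsM cabs_expi mulr1; exact: cE.
rewrite /b RintegralD// !RintegralZl//.
exact: (@sq_combination_lt _ K e (N.+1)%:R _ r2).
Qed.

End FourierCharacterization.

(** * Minimal densities and the matrix $B_N$ *)

Section MinimalDensity.
Variables (R : realType) (N : nat).
Notation mu := (@lebesgue_measure R).
Notation integrable u := (mu.-integrable (@freq R) (EFin \o u)).
Implicit Types (f : R -> R) (c : 'cV[R[i]]_(N.+1)).

(** The inverses of [R] and [\bar R] differ only at zeros of [f], where they are 0 and [+oo]; so the
    former is dominated by the latter. *)
Lemma minimal_integrable_inv f : minimal f -> integrable (fun x => (f x)^-1).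
Proof.
move=> fm; have /integrableP[mf _] := fm.
have fineE : (fun x => (f x)^-1) = fun x => fine ((f x)%:E)^-1%E.
  by apply/funext => x; rewrite inver; case: eqP => [->|//]; rewrite invr0.
apply: (le_integrable _ _ _ fm) => //.
  by apply/measurable_EFinP; rewrite fineE; exact: measurableT_comp.
move=> x _ /=; rewrite inver; case: eqP => [->|//].
by rewrite invr0 normr0 leey.
Qed.

Lemma minimal_ae_neq0 f : minimal f -> {ae mu, forall x, freq x -> f x != 0}.
Proof.
move=> fm; have := @integrable_ae _ _ _ mu _ (@measurable_freq R) _ fm.
apply: filterS => x fin fx; have := fin fx.
by rewrite inver; case: eqP.
Qed.

Lemma ae_eq_Rintegral (u v : R -> R) : integrable u -> integrable v ->
  {ae mu, forall x, freq x -> u x = v x} ->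
  Rintegral mu (@freq R) u = Rintegral mu (@freq R) v.
Proof.
move=> iu iv uv; rewrite /Rintegral; congr fine; apply: ae_eq_integral => //.
- exact: measurable_int iu.
- exact: measurable_int iv.
- by move: uv; apply: filterS => x /= uv fx; rewrite uv.
Qed.

Lemma ge0_Rintegral_eq0 (u : R -> R) : integrable u ->
  (forall x, freq x -> 0 <= u x) -> Rintegral mu (@freq R) u = 0 ->
  {ae mu, forall x, freq x -> u x = 0}.
Proof.
move=> iu u0 Iu0; have : ae_eq mu (@freq R) (EFin \o u) (cst 0%E).
  apply/ae_eq_integral_abs => //; first exact: measurable_int iu.
  transitivity (\int[mu]_(x in @freq R) (u x)%:E)%E.
    by apply: eq_integral => x; rewrite inE => fx /=; rewrite ger0_norm// u0.
  rewrite -[LHS]fineK; last exact: integrable_fin_num.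
  by rewrite [fine _]Iu0.
by apply: filterS => x h fx; have := h fx => -[].
Qed.

Lemma trigpolyE c : trigpoly c =
  trig_sum [seq (c j 0, j%:Z) | j <- index_enum 'I_N.+1].
Proof. by apply/funext => x; rewrite /trig_sum big_map. Qed.

Lemma ess_cbounded_trigpoly c : ess_cbounded (trigpoly c).
Proof. by rewrite trigpolyE; exact: ess_cbounded_trig_sum. Qed.

Lemma fourier_trigpoly c (k : 'I_N.+1) :
  cintegral (fun x => trigpoly c x * expi (- k%:Z) x) = (2 * pi)%:C * c k 0.
Proof.
rewrite trigpolyE fourier_trig_sum big_map /=; congr (_ * _).
by rewrite (big_pred1 k)// => j; rewrite /= eqz_nat.
Qed.

Lemma conj_trigpoly c (x : R) :
  ((trigpoly c x)^*)%R = \sum_k (c k 0)^* * expi (- k%:Z) x.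
Proof.
rewrite rmorph_sum; apply: eq_bigr => k _; rewrite rmorphM.
by congr (_ * _); exact: conj_expi.
Qed.

(** * $B_N$ as the Gram matrix of the exponentials in $L_2(f^{-1})$ *)

Section Gram.
Variable f : R -> R.
Hypothesis fm : minimal f.

Lemma cintegrable_inv : cintegrable (fun x => ((f x)^-1)%:C).
Proof.
split; first exact: minimal_integrable_inv.
exact: integrable_cst.
Qed.

Lemma cintegrableM_inv (h : R -> R[i]) : ess_cbounded h ->
  cintegrable (fun x => h x * ((f x)^-1)%:C).
Proof. by move=> bh; apply: cintegrableM_ess_cbounded => //; exact: cintegrable_inv. Qed.

(** Splitting the exponential of $-(k-j)$ as that of $j$ times that of $-k$ turns linear algebra
    with $B_N$ into Fourier coefficients of [trigpoly c] divided by [f]. *)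
Lemma Bmx_mulE c (k : 'I_N.+1) : (Bmx N f *m c) k 0 =
  ((2 * pi)^-1)%:C *
  cintegral (fun x => trigpoly c x * ((f x)^-1)%:C * expi (- k%:Z) x).
Proof.
have iF (j : 'I_N.+1) : cintegrable (fun x =>
    ((f x)^-1)%:C * expi (- (k%:Z - j%:Z)) x).
  under eq_fun do rewrite mulrC.
  exact/cintegrableM_inv/ess_cbounded_expi.
have -> : (fun x => trigpoly c x * ((f x)^-1)%:C * expi (- k%:Z) x) =
    (fun x => \sum_j c j 0 * (((f x)^-1)%:C * expi (- (k%:Z - j%:Z)) x)).
  apply/funext => x; rewrite /trigpoly !mulr_suml; apply: eq_bigr => j _.
  by rewrite opprB expiD; ring.
rewrite cintegral_sum; last by move=> j; exact: cintegrableZ.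
rewrite mxE mulr_sumr; apply: eq_bigr => j _.
by rewrite mxE cintegralZ//; ring.
Qed.

Lemma Bmx_quad c : \sum_k (c k 0)^* * (Bmx N f *m c) k 0 =
  ((2 * pi)^-1 * \int[mu]_(x in @freq R) (cabs (trigpoly c x) ^+ 2 * (f x)^-1))%:C.
Proof.
under eq_bigr do rewrite Bmx_mulE mulrCA.
rewrite -mulr_sumr rmorphM /=; congr (_ * _).
rewrite -cintegral_real.
have bT := ess_cbounded_trigpoly c.
have iF (k : 'I_N.+1) : cintegrable (fun x =>
    trigpoly c x * ((f x)^-1)%:C * expi (- k%:Z) x).
  under eq_fun do rewrite mulrC.
  apply: cintegrableM_ess_cbounded; first exact: ess_cbounded_expi.
  exact: cintegrableM_inv.
under eq_bigr do rewrite -cintegralZ//.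
rewrite -cintegral_sum; last by move=> k; exact: cintegrableZ.
congr cintegral; apply/funext => x.
rewrite rmorphM /= cabs_sqC conj_trigpoly mulrAC mulr_sumr mulr_suml.
by apply: eq_bigr => k _; ring.
Qed.

Lemma integrable_cabs_sq_inv c :
  integrable (fun x => cabs (trigpoly c x) ^+ 2 * (f x)^-1).
Proof.
apply: integrableM_ess_bounded; last exact: minimal_integrable_inv.
exact/ess_bounded_cabs_sq/ess_cbounded_trigpoly.
Qed.

Hypothesis f_ge0 : forall x, freq x -> 0 <= f x.

(** A kernel vector annihilates the quadratic form of [Bmx_quad], so its trigonometric polynomial
    vanishes almost everywhere, and so do its coefficients. *)
Lemma Bmx_unit : Bmx N f \in unitmx.
Proof.
(* [det0P] supplies a row vector killed from the left; transposing first makes it a column vector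
   killed by [Bmx N f]. *)
rewrite -unitmx_tr unitmxE unitfE; apply/det0P => -[v v0 vB].
pose c := v^T; have Bc : Bmx N f *m c = 0.
  by apply: trmx_inj; rewrite trmx_mul trmxK vB trmx0.
have /complexI I0 : ((2 * pi)^-1 *
    \int[mu]_(x in @freq R) (cabs (trigpoly c x) ^+ 2 * (f x)^-1))%:C = 0%:C.
  by rewrite -Bmx_quad Bc big1// => k _; rewrite [X in _ * X]mxE mulr0.
have pi0 := pi_gt0 R.
have {}I0 : \int[mu]_(x in @freq R) (cabs (trigpoly c x) ^+ 2 * (f x)^-1) = 0.
  by move/eqP: I0; rewrite mulf_eq0 invr_eq0 mulf_eq0 pnatr_eq0 (gt_eqF pi0) => /eqP.
have T0 : {ae mu, forall x, freq x -> trigpoly c x = 0}.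
  have := ge0_Rintegral_eq0 (integrable_cabs_sq_inv c) _ I0.
  have pos x : freq x -> 0 <= cabs (trigpoly c x) ^+ 2 * (f x)^-1.
    by move=> fx; rewrite mulr_ge0 ?sqr_ge0// invr_ge0 f_ge0.
  move=> /(_ pos); move: (minimal_ae_neq0 fm); apply: filterS2 => x fn Tf fx.
  have /eqP := Tf fx; rewrite mulf_eq0 invr_eq0 (negPf (fn fx)) orbF.
  by rewrite sqrf_eq0 => /eqP /Normc.eq0_normc.
move/eqP: v0; apply; apply/matrixP => i k; rewrite ord1 mxE.
have -> : v 0 k = c k 0 by rewrite mxE.
have : (2 * pi)%:C * c k 0 = 0.
  rewrite -fourier_trigpoly /cintegral.
  have bTe : ess_cbounded (fun x => trigpoly c x * expi (- k%:Z) x).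
    by apply: ess_cboundedM; [exact: ess_cbounded_trigpoly|exact: ess_cbounded_expi].
  have [iRe iIm] := cintegrable_ess_cbounded bTe.
  rewrite (ae_eq_Rintegral iRe (integrable_cst 0)); last first.
    by move: T0; apply: filterS => x T0 fx; rewrite T0// mul0r.
  rewrite (ae_eq_Rintegral iIm (integrable_cst 0)); last first.
    by move: T0; apply: filterS => x T0 fx; rewrite T0// mul0r.
  by rewrite Rintegral_freq_cst mul0r.
move/eqP; rewrite mulf_eq0 => /orP[|/eqP //].
by rewrite eq_complex /= eqxx andbT mulf_eq0 pnatr_eq0 (gt_eqF pi0).
Qed.

End Gram.
End MinimalDensity.

(** * Lower bounds for the distance to $L_2^N(f)$ *)

Section LeastSquares.
Variable R : realType.
Notation mu := (@lebesgue_measure R).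
Implicit Types (f : R -> R) (g h : R -> R[i]).

Lemma L2dist_ge0 f g h : (forall x, freq x -> 0 <= f x) -> (0 <= L2dist f g h)%E.
Proof.
move=> f0; apply: mule_ge0; first by rewrite lee_fin invr_ge0 mulr_ge0// pi_ge0.
by apply: integral_ge0 => x fx; rewrite lee_fin mulr_ge0 ?sqr_ge0// f0.
Qed.

Lemma cmeasurable_cabs_sqB g h : cmeasurable g -> cmeasurable h ->
  measurable_fun (@freq R) (fun x => cabs (g x - h x) ^+ 2).
Proof.
move=> [g1 g2] [h1 h2]; under eq_fun do rewrite cabs_sq !raddfB /=.
by apply: measurable_funD; apply: measurable_funX; exact: measurable_funB.
Qed.

(* Integrated form of |u + v|^2 <= (1 + t) |u|^2 + (1 + 1/t) |v|^2. *)
Lemma L2dist_split f g h s (t : R) : 0 < t -> spectral_density f ->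
  cmeasurable g -> cmeasurable h -> cmeasurable s ->
  (L2dist f g s <=
     (1 + t)%:E * L2dist f g h + (1 + t^-1)%:E * L2dist f h s)%E.
Proof.
move=> t0 [f0 if_] mg mh ms.
have mf : measurable_fun (@freq R) f.
  by apply/measurable_EFinP; exact: measurable_int if_.
have ti0 : 0 < t^-1 by rewrite invr_gt0.
have m1 : measurable_fun (@freq R) (fun x => (cabs (g x - h x) ^+ 2 * f x)%:E).
  by apply/measurable_EFinP/measurable_funM => //; exact: cmeasurable_cabs_sqB.
have m2 : measurable_fun (@freq R) (fun x => (cabs (h x - s x) ^+ 2 * f x)%:E).
  by apply/measurable_EFinP/measurable_funM => //; exact: cmeasurable_cabs_sqB.
have m3 : measurable_fun (@freq R) (fun x => (cabs (g x - s x) ^+ 2 * f x)%:E).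
  by apply/measurable_EFinP/measurable_funM => //; exact: cmeasurable_cabs_sqB.
have pos (a b : R -> R[i]) x : freq x -> (0 <= (cabs (a x - b x) ^+ 2 * f x)%:E)%E.
  by move=> fx; rewrite lee_fin mulr_ge0 ?sqr_ge0// f0.
have p2 : 0 <= (2 * pi)^-1 :> R by rewrite invr_ge0 mulr_ge0// pi_ge0.
have t1 : (0 <= (1 + t)%:E)%E by rewrite lee_fin; lra.
have t2 : (0 <= (1 + t^-1)%:E)%E by rewrite lee_fin; lra.
rewrite /L2dist !(muleCA _ ((2 * pi)^-1)%:E) -ge0_muleDr; last 2 first.
- by apply: mule_ge0 => //; apply: integral_ge0 => x; exact: pos.
- by apply: mule_ge0 => //; apply: integral_ge0 => x; exact: pos.
apply: lee_wpmul2l => //.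
rewrite -!ge0_integralZl//; last 2 first.
- by move=> x; exact: pos.
- by move=> x; exact: pos.
rewrite -ge0_integralD//; last 4 first.
- by move=> x fx; apply: mule_ge0 => //; exact: pos.
- exact: measurable_funeM.
- by move=> x fx; apply: mule_ge0 => //; exact: pos.
- exact: measurable_funeM.
apply: ge0_le_integral => //.
- by move=> x; exact: pos.
- by apply: emeasurable_funD; exact: measurable_funeM.
move=> x fx; rewrite -!EFinM -EFinD lee_fin (mulrA (1 + t)) (mulrA (1 + t^-1)).
rewrite -mulrDl ler_wpM2r ?f0//.
have -> : g x - s x = (g x - h x) + (h x - s x) by rewrite addrA subrK.
move: (g x - h x) (h x - s x) => [a b] [c d]; rewrite !cabs_sq /=.
have sq (p q : R) : (p + q) ^+ 2 <= (1 + t) * p ^+ 2 + (1 + t^-1) * q ^+ 2.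
  have -> : (1 + t) * p ^+ 2 + (1 + t^-1) * q ^+ 2 =
    (p + q) ^+ 2 + t^-1 * (t * p - q) ^+ 2 by field; lra.
  by rewrite lerDl mulr_ge0 ?sqr_ge0// ltW.
by have := sq a c; have := sq b d; rewrite !mulrDr; lra.
Qed.

Lemma le_of_split_bound (K X : R) : 0 <= X ->
  (forall t e : R, 0 < t -> 0 < e -> K <= (1 + t) * X + (1 + t^-1) * e) -> K <= X.
Proof.
move=> X0 H; apply/ler_addgt0Pr => e e0.
(* The hypothesis is used with second parameter $t^2$, which tames the factor $1/t$: the excess over
   [X] is $tX + t^2 + t \le t(X+2) \le e$ since $t \le 1$. *)
pose t := Num.min 1 (e / (X + 2)).
have X2 : 0 < X + 2 by lra.
have t0 : 0 < t by rewrite lt_min ltr01 divr_gt0.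
have t1 : t <= 1 by rewrite ge_min lexx.
have te : t * (X + 2) <= e by rewrite -ler_pdivlMr// ge_min lexx orbT.
apply: le_trans (H t (t ^+ 2) t0 (exprn_gt0 _ t0)) _.
have -> : (1 + t^-1) * t ^+ 2 = t ^+ 2 + t by field; lra.
by nra.
Qed.

(* It suffices to bound the distance to the span from below: [L2N] only adds limits. *)
Lemma L2dist_L2N_ge N f g h (K : R) : spectral_density f -> ess_cbounded g ->
  (forall s, in_span N s -> (K%:E <= L2dist f g s)%E) ->
  L2N N f h -> (K%:E <= L2dist f g h)%E.
Proof.
move=> fd bg Ks [[mh _] hs]; have [f0 if_] := fd.
have mg : cmeasurable g by case: bg => -[? _] [? _]; split.
have L0 := L2dist_ge0 g h f0.
case LE : (L2dist f g h) L0 => [X| |] L0; [|exact: leey|by []].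
have X0 : 0 <= X by rewrite -lee_fin.
rewrite lee_fin; apply: le_of_split_bound => // t e t0 e0.
have [s sN se] := hs e e0.
have ms : cmeasurable s.
  have [r [c [_ ->]]] := sN.
  have : ess_cbounded (fun x => \sum_(j <- r) c j * expi j x).
    apply: (@ess_cbounded_sum _ _ r (fun j x => c j * expi j x)) => j.
    by apply: ess_cboundedM; [exact: ess_cbounded_cst|exact: ess_cbounded_expi].
  by case=> -[? _] [? _]; split.
rewrite -lee_fin; apply: le_trans (Ks s sN) _.
apply: le_trans (L2dist_split t0 fd mg mh ms) _.
rewrite LE (EFinD ((1 + t) * X)) !EFinM; apply: leeD; first exact: lexx.
apply: lee_wpmul2l; last exact: ltW.
by rewrite lee_fin addr_ge0// invr_ge0 ltW.
Qed.

Lemma in_span_trig_sum N (s : R -> R[i]) : in_span N s ->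
  exists2 l : seq (R[i] * int), all (fun t => observed N t.2) l & s = trig_sum l.
Proof.
move=> [r [c [rN ->]]]; exists [seq (c j, j) | j <- r].
  by rewrite all_map; apply: sub_all rN.
by apply/funext => x; rewrite /trig_sum big_map.
Qed.

Lemma fourier_in_span N (s : R -> R[i]) (k : 'I_N.+1) : in_span N s ->
  ess_cbounded s /\ cintegral (fun x => s x * expi (- k%:Z) x) = 0.
Proof.
move=> /in_span_trig_sum[l lN ->]; split; first exact: ess_cbounded_trig_sum.
rewrite fourier_trig_sum big_seq_cond big1 ?mulr0// => t /andP[/(allP lN) + /eqP tk].
rewrite tk; suff /negPf -> : ~~ observed N k by [].
by rewrite /observed negb_or -!leNgt !lez_nat leq0n -ltnS ltn_ord.
Qed.

End LeastSquares.

(** * The estimate $h(f_0)$ and its membership in every $L_2^N(f)$ *)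

Section SaddlePoint.
Variables (R : realType) (N : nat) (a : 'cV[R[i]]_(N.+1)) (f0 : R -> R).
Notation mu := (@lebesgue_measure R).
Notation integrable u := (mu.-integrable (@freq R) (EFin \o u)).
Notation I u := (Rintegral mu (@freq R) u).
Notation h0 := (hchar a f0).
Notation C := (CN a f0).

Hypothesis fd : spectral_density f0.
Hypothesis fm : minimal f0.
Hypothesis hb : ae_bounded h0.

Lemma ess_cbounded_CN : ess_cbounded C.
Proof. exact: ess_cbounded_trigpoly. Qed.

Lemma normr_Re_le (z : R[i]) : `|complex.Re z| <= cabs z.
Proof. by case: z => p q /=; rewrite -sqrtr_sqr ler_sqrt ?lerDl ?addr_ge0 ?sqr_ge0. Qed.

Lemma normr_Im_le (z : R[i]) : `|complex.Im z| <= cabs z.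
Proof. by case: z => p q /=; rewrite -sqrtr_sqr ler_sqrt ?lerDr ?addr_ge0 ?sqr_ge0. Qed.

Lemma ess_cbounded_hchar : ess_cbounded h0.
Proof.
have hE : h0 = fun x => trigpoly a x + (-1) * (C x * ((f0 x)^-1)%:C).
  by apply/funext => x; rewrite mulN1r.
(* Integrability supplies the measurability of the two components. *)
have [iRe iIm] : cintegrable h0.
  rewrite hE; apply: cintegrableD.
    exact/cintegrable_ess_cbounded/ess_cbounded_trigpoly.
  exact/cintegrableZ/cintegrableM_inv/ess_cbounded_CN.
have [M hM] := hb.
split; split.
- by apply/measurable_EFinP; exact: measurable_int iRe.
- exists M; move: hM; apply: filterS => x hM fx.
  exact: le_trans (normr_Re_le _) (hM fx).
- by apply/measurable_EFinP; exact: measurable_int iIm.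
exists M; move: hM; apply: filterS => x hM fx.
exact: le_trans (normr_Im_le _) (hM fx).
Qed.

Lemma Bmx_mul_invmx : Bmx N f0 *m (invmx (Bmx N f0) *m a) = a.
Proof. by rewrite mulKVmx// Bmx_unit//; case: fd. Qed.

(** By [Bmx_mulE], $B_N^0 (B_N^0)^{-1} a = a$ says that $C / f_0$ and [trigpoly a] share their
    coefficients of index $0..N$. *)
Lemma fourier_hchar (k : 'I_N.+1) :
  cintegral (fun x => h0 x * expi (- k%:Z) x) = 0.
Proof.
have be := ess_cbounded_expi R (- k%:Z).
have -> : (fun x => h0 x * expi (- k%:Z) x) = fun x =>
    trigpoly a x * expi (- k%:Z) x +
    (-1) * (C x * ((f0 x)^-1)%:C * expi (- k%:Z) x).
  by apply/funext => x; rewrite /hchar mulrBl mulN1r.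
have i1 : cintegrable (fun x => trigpoly a x * expi (- k%:Z) x).
  by apply/cintegrable_ess_cbounded/ess_cboundedM => //; exact: ess_cbounded_trigpoly.
have i2 : cintegrable (fun x => C x * ((f0 x)^-1)%:C * expi (- k%:Z) x).
  under eq_fun do rewrite mulrC.
  by apply: cintegrableM_ess_cbounded => //; exact/cintegrableM_inv/ess_cbounded_CN.
rewrite cintegralD//; last exact: cintegrableZ.
rewrite cintegralZ// fourier_trigpoly -{1}Bmx_mul_invmx Bmx_mulE// mulrA.
have pi0 := pi_gt0 R.
rewrite -rmorphM /= divff ?mul1r ?mulN1r ?subrr//.
by rewrite mulf_neq0 ?pnatr_eq0// gt_eqF.
Qed.

Lemma L2N_hchar f : spectral_density f -> L2N N f h0.
Proof.
by move=> fd'; apply: L2N_fourier0 => //; [exact: ess_cbounded_hchar|exact: fourier_hchar].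
Qed.

(** * Consequences of the equation $f_0 = \alpha_1 |C_N^0|$ *)

Variable alpha : R.
Hypothesis alpha0 : 0 < alpha.
Hypothesis fE : ae_equal f0 (fun x => alpha * cabs (C x)).

Lemma ae_cabs_CN :
  {ae mu, forall x, freq x -> 0 < f0 x /\ cabs (C x) = alpha^-1 * f0 x}.
Proof.
move: fE (minimal_ae_neq0 fm); apply: filterS2 => x fx fn xf.
split; first by rewrite lt_neqAle eq_sym fn//; case: fd => -> .
by rewrite fx// mulKf// gt_eqF.
Qed.

Lemma Delta_hchar f : spectral_density f ->
  Delta a h0 f = (alpha^-1 ^+ 2 * ((2 * pi)^-1 * I f))%:E.
Proof.
move=> [f_ge0 if_]; have bA := ess_cbounded_trigpoly a.
have bh := ess_cbounded_hchar.
rewrite /Delta L2dist_ess_cbounded//; congr EFin; rewrite mulrCA; congr (_ * _).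
rewrite -RintegralZl//; apply: ae_eq_Rintegral.
- by apply: integrableM_ess_bounded => //; exact/ess_bounded_cabs_sq/ess_cboundedB.
- exact: integrableZR.
move: ae_cabs_CN; apply: filterS => x Cx fx; have [f0x cC] := Cx fx.
rewrite /hchar opprB addrC subrK cabsM cabs_real cC normfV gtr0_norm//.
by rewrite mulfK// gt_eqF.
Qed.

(** Pythagoras: for [s] in the span, the error splits as $C/f_0 + v$ with $v = h_0 - s$. Its square
    times $f_0$ is $|C|^2/f_0 + 2\,\mathrm{Re}(\overline{C} v) + |v|^2 f_0$, whose middle term
    integrates to 0. *)
Lemma Delta_hchar_min g : L2N N f0 g -> (Delta a h0 f0 <= Delta a g f0)%E.
Proof.
rewrite Delta_hchar//; have [f0_ge0 if0] := fd.
have bA := ess_cbounded_trigpoly a; have bh := ess_cbounded_hchar.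
apply: L2dist_L2N_ge => // s sN.
have bs : ess_cbounded s by have [] := fourier_in_span ord0 sN.
rewrite L2dist_ess_cbounded//.
have bv := ess_cboundedB bh bs.
pose v x := h0 x - s x; pose q x := complex.Re ((C x)^*%R * v x).
have bCv : ess_cbounded (fun x => (C x)^*%R * v x).
  by apply: ess_cboundedM => //; exact/ess_cbounded_conj/ess_cbounded_CN.
have iq : integrable q by have [] := cintegrable_ess_cbounded bCv.
(* $\overline{C}$ involves only the exponentials of index $-k$ with [k] in $0..N$, and neither [h0]
   nor [s] has a Fourier coefficient of such an index [k]. *)
have q0 : I q = 0.
  suff : cintegral (fun x => (C x)^*%R * v x) = 0 by case.
  have -> : (fun x => (C x)^*%R * v x) = fun x =>
      \sum_k ((invmx (Bmx N f0) *m a) k 0)^*%R *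
        (h0 x * expi (- k%:Z) x + (-1) * (s x * expi (- k%:Z) x)).
    apply/funext => x; rewrite conj_trigpoly mulr_suml.
    by apply: eq_bigr => k _; rewrite /v; ring.
  have ih (k : 'I_N.+1) (h : R -> R[i]) : ess_cbounded h ->
      cintegrable (fun x => h x * expi (- k%:Z) x).
    move=> bh'; apply/cintegrable_ess_cbounded/ess_cboundedM => //.
    exact: ess_cbounded_expi.
  have ihs k : cintegrable (fun x => h0 x * expi (- (nat_of_ord k)%:Z) x +
      (-1) * (s x * expi (- (nat_of_ord (k : 'I_N.+1))%:Z) x)).
    by apply: cintegrableD; [exact: ih|apply: cintegrableZ; exact: ih].
  rewrite cintegral_sum; last by move=> k; exact: cintegrableZ.
  rewrite big1// => k _; rewrite cintegralZ// cintegralD ?cintegralZ.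
  - by have [_ ->] := fourier_in_span k sN; rewrite fourier_hchar mulr0 addr0 mulr0.
  - exact: ih.
  - exact: ih.
  - by apply: cintegrableZ; exact: ih.
have iv : integrable (fun x => cabs (v x) ^+ 2 * f0 x).
  by apply: integrableM_ess_bounded => //; exact: ess_bounded_cabs_sq.
have -> : \int[mu]_(x in @freq R) (cabs (trigpoly a x - s x) ^+ 2 * f0 x) =
    \int[mu]_(x in @freq R)
      (alpha^-1 ^+ 2 * f0 x + (2 * q x + cabs (v x) ^+ 2 * f0 x)).
  apply: ae_eq_Rintegral.
  - by apply: integrableM_ess_bounded => //; exact/ess_bounded_cabs_sq/ess_cboundedB.
  - by apply: integrableDR; [exact: integrableZR|apply: integrableDR => //;
      exact: integrableZR].
  move: ae_cabs_CN; apply: filterS => x Cx fx; have [f0x cC] := Cx fx.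
  have -> : trigpoly a x - s x = C x * ((f0 x)^-1)%:C + v x.
    by rewrite /v /hchar; ring.
  have : cabs (C x) ^+ 2 = (alpha^-1 * f0 x) ^+ 2 by rewrite cC.
  rewrite /q; move: (C x) (v x) (f0 x) f0x => [p1 p2] [v1 v2] F F0.
  rewrite !cabs_sq /= => cF.
  transitivity ((p1 ^+ 2 + p2 ^+ 2) / F +
      (2 * (p1 * v1 + p2 * v2) + (v1 ^+ 2 + v2 ^+ 2) * F)).
    by field; rewrite gt_eqF.
  rewrite cF; congr (_ + (_ * _ + _)); last by ring.
  by field; rewrite !gt_eqF.
rewrite RintegralD//; last 2 first.
- exact: integrableZR.
- by apply: integrableDR => //; exact: integrableZR.
rewrite RintegralD//; last exact: integrableZR.
rewrite !RintegralZl// q0 mulr0 add0r lee_fin mulrCA ler_wpM2l//.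
  by rewrite invr_ge0 mulr_ge0// pi_ge0.
by rewrite lerDl; apply: Rintegral_ge0 => x fx; rewrite mulr_ge0 ?sqr_ge0// f0_ge0.
Qed.

(** With $c = (B_N^0)^{-1} a$ the form becomes that of $B_N^0$ at [c], the mean of $|C|^2 / f_0 =
    \alpha^{-2} f_0$. *)
Lemma Binv_form_power : Binv_form a f0 =
  (alpha^-1 ^+ 2 * ((2 * pi)^-1 * I f0))%:C.
Proof.
have [f0_ge0 if0] := fd.
set c := invmx (Bmx N f0) *m a.
have quad : \sum_k (c k 0)^*%R * a k 0 =
    (alpha^-1 ^+ 2 * ((2 * pi)^-1 * I f0))%:C.
  transitivity (\sum_k (c k 0)^*%R * (Bmx N f0 *m c) k 0).
    by rewrite Bmx_mul_invmx.
  rewrite Bmx_quad//; congr (_%:C); rewrite mulrCA; congr (_ * _).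
  rewrite -RintegralZl//; apply: ae_eq_Rintegral.
  - exact: integrable_cabs_sq_inv.
  - exact: integrableZR.
  move: ae_cabs_CN; apply: filterS => x Cx fx; have [f0x cC] := Cx fx.
  rewrite -[trigpoly c x]/(C x) cC; field.
  by rewrite !gt_eqF.
rewrite /Binv_form /inner -/c.
(* [inner] conjugates its second argument, so the form is the conjugate of [quad], which is real. *)
transitivity ((\sum_k (c k 0)^*%R * a k 0)^*%R).
  rewrite rmorph_sum; apply: eq_bigr => k _.
  by rewrite rmorphM /= conjCK.
by rewrite quad; apply/eqP; rewrite eq_complex /= oppr0 !eqxx.
Qed.

(** * Rescaling and the full power of $f_0$ *)

Lemma power_gt0 : 0 < (2 * pi)^-1 * I f0.
Proof.
have pi0 := pi_gt0 R; have [f0_ge0 if0] := fd.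
rewrite mulr_gt0 ?invr_gt0 ?mulr_gt0// lt_neqAle Rintegral_ge0// andbT.
apply/eqP => /esym /(ge0_Rintegral_eq0 if0 f0_ge0) f00.
(* A density both zero and nonzero almost everywhere would make 1 and 0 agree almost everywhere on
   an interval of length $2\pi$. *)
have : \int[mu]_(x in @freq R) (1 : R) = \int[mu]_(x in @freq R) (0 : R).
  apply: ae_eq_Rintegral; [exact: integrable_cst|exact: integrable_cst|].
  move: f00 (minimal_ae_neq0 fm); apply: filterS2 => x f00 fn fx.
  by have := fn fx; rewrite f00// eqxx.
by rewrite !Rintegral_freq_cst; lra.
Qed.

Lemma scale_D0 (P1 k : R) : 0 <= k -> k * ((2 * pi)^-1 * I f0) <= P1 ->
  D0 P1 (fun x => k * f0 x).
Proof.
have [f0_ge0 if0] := fd => k0 kP; split; first split.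
- by move=> x fx; rewrite mulr_ge0// f0_ge0.
- exact: integrableZR.
- by rewrite RintegralZl// mulrCA.
Qed.

Lemma minimal_scale (k : R) : 0 < k -> minimal (fun x => k * f0 x).
Proof.
move=> k0; rewrite /minimal.
have -> : (fun x => ((k * f0 x)%:E)^-1%E) =
    (fun x => (k^-1)%:E * ((f0 x)%:E)^-1)%E.
  apply/funext => x; rewrite !inver mulf_eq0 (gt_eqF k0) /=.
  by case: eqP => _; [rewrite gt0_muley// lte_fin invr_gt0|rewrite -EFinM invfM].
exact: (@integrableZl _ _ _ mu _ (@measurable_freq R) _ _ fm).
Qed.

(** $B_N$ is homogeneous of degree $-1$ in the density, so its inverse has degree 1. *)
Lemma Binv_form_scale (k : R) : 0 < k ->
  Binv_form a (fun x => k * f0 x) = k%:C * Binv_form a f0.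
Proof.
move=> k0.
have kC0 : k%:C != 0 by rewrite eq_complex /= eqxx andbT gt_eqF.
have BE : Bmx N (fun x => k * f0 x) = (k%:C)^-1 *: Bmx N f0.
  apply/matrixP => i j; rewrite !mxE mulrCA; congr (_ * _).
  rewrite -cintegralZ; last first.
    under eq_fun do rewrite mulrC.
    exact/cintegrableM_inv/ess_cbounded_expi.
  congr cintegral; apply/funext => x.
  by rewrite mulrA -fmorphV -rmorphM /= -invfM.
rewrite /Binv_form BE invmxZ ?invrK; last first.
  by rewrite unitmxZ ?unitfE ?invr_eq0//; apply: Bmx_unit => //; case: fd.
rewrite -scalemxAl /inner mulr_sumr; apply: eq_bigr => i _.
by rewrite mxE mulrA.
Qed.

(* Otherwise rescaling f0 to full power would increase the maximized form. *)
Lemma power_eq_of_solves_max (P1 : R) : solves_max a (D0 P1) f0 ->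
  (2 * pi)^-1 * I f0 = P1.
Proof.
move=> [[_ f0P] _ fmax]; apply/eqP; rewrite eq_le f0P /= leNgt; apply/negP => ltP.
have m0 := power_gt0; set m := _ * _ in ltP m0.
have k1 : 1 < P1 / m by rewrite ltr_pdivlMr// mul1r.
have k0 : 0 < P1 / m by rewrite (lt_trans ltr01).
have := fmax _ (scale_D0 (ltW k0) _) (minimal_scale k0).
rewrite -/m divfK ?gt_eqF// => /(_ (lexx _)).
(* [Binv_form_power] makes both sides real, which reduces the order of [R[i]] to that of [R]. *)
rewrite Binv_form_scale// Binv_form_power -rmorphM /= lecR leNgt -/m.
by rewrite ltr_pMl ?k1// mulr_gt0// exprn_gt0// invr_gt0.
Qed.

End SaddlePoint.

Theorem theorem7p4 (R : realType) (N : nat) (a : 'cV[R[i]]_(N.+1)) (P1 : R)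
    (f0 : R -> R) (alpha1 : R) :
  0 < P1 ->
  D0 P1 f0 ->
  minimal f0 ->
  ae_bounded (hchar a f0) ->
  0 < alpha1 ->
  ae_equal f0 (fun x => alpha1 * cabs (CN a f0 x)) ->
  solves_max a (D0 P1) f0 ->
  [/\ spectral_char a f0 (hchar a f0),
      least_favourable a (D0 P1) f0 &
      minimax_robust a (D0 P1) (hchar a f0)].
Proof.
move=> P1_gt0 f0D fm hb al fE smax; have fd : spectral_density f0 by case: f0D.
have pw := power_eq_of_solves_max fd fm al fE smax.
have Dh f : D0 P1 f -> (Delta a (hchar a f0) f <= Delta a (hchar a f0) f0)%E.
  move=> [fd' fP]; rewrite !(Delta_hchar fd fm hb al fE)// lee_fin pw.
  by rewrite ler_wpM2l// exprn_ge0// invr_ge0 ltW.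
have hL f : D0 P1 f -> L2N N f (hchar a f0) by move=> [fd' _]; exact: L2N_hchar.
have hmin g : L2N N f0 g -> (Delta a (hchar a f0) f0 <= Delta a g f0)%E.
  exact: (Delta_hchar_min fd fm hb al fE).
have hS : spectral_char a f0 (hchar a f0) by split => //; exact: hL.
split => //.
- split=> //; exists (hchar a f0) => // f h Df [_ hmin'].
  (* $\Delta(h(f);f) \le \Delta(h^0;f) \le \Delta(h^0;f_0)$: [hchar a f0] is an admissible
     competitor at every [f] of the class. *)
  exact: le_trans (hmin' _ (hL f Df)) (Dh f Df).
split; first exact: hL.
apply/eqP; rewrite eq_le; apply/andP; split.
  by apply: ereal_inf_lbound; exists (hchar a f0).
apply: le_ereal_inf_tmp => _ [h hH <-].
(* Saddle point chain: $\sup_f \Delta(h^0;f) \le \Delta(h^0;f_0) \le \Delta(h;f_0) \le \sup_f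
   \Delta(h;f)$. *)
apply: (@le_trans _ _ (Delta a (hchar a f0) f0)).
  by apply: ge_ereal_sup => _ [f Df <-]; exact: Dh.
apply: (@le_trans _ _ (Delta a h f0)); first by apply: hmin; exact: hH.
by apply: ereal_sup_ubound; exists f0.
Qed.
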